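(* Let $A=(a_{i,j})$ be a real $\ell\times\ell$ matrix satisfying (P1)–(P3), and assume $A$ is symmetrizable, indecomposable, and $\ell\ge 2$. Let $\mathfrak g=\mathfrak g(A)$ be the associated generalized Kac–Moody algebra with Cartan subalgebra $\mathfrak h$. Let $$\mathfrak g^o_{\mathrm{nil}}:=\{x\in\mathfrak g:\ \operatorname{ad}x \text{ acts locally nilpotently on }\mathfrak g\},$$ and let $\mathfrak g_{\mathrm{nil}}\subset\mathfrak g$ be the Lie subalgebra generated by $\mathfrak g^o_{\mathrm{nil}}$. Then $$\mathfrak g'(B)\subset \mathfrak g_{\mathrm{nil}}\subset \mathfrak g'(B)+\mathfrak h .$$
   Context: Let $A=(a_{i,j})_{1\le i,j\le \ell}$ be a real matrix with: (P1) either $a_{i,i}=2$ or $a_{i,i}\le 0$; (P2) $a_{i,j}\le 0$ for $i\ne j$, and $a_{i,j}\in\mathbb Z$ whenever $a_{i,i}=2$; (P3) $a_{i,j}=0$ iff $a_{j,i}=0$. A realization of $A$ is a triple $(\mathfrak h,\Pi,\Pi^\vee)$ with $\mathfrak h$ a complex vector space, $\Pi=\{\alpha_1,\dots,\alpha_\ell\}\subset\mathfrak h^*$ and $\Pi^\vee=\{\alpha_1^\vee,\dots,\alpha_\ell^\vee\}\subset\mathfrak h$ linearly independent, $\alpha_j(\alpha_i^\vee)=a_{i,j}$, and $\dim\mathfrak h=2\ell-\operatorname{rank}A$ (unique up to isomorphism). The generalized Kac–Moody (Borcherds) algebra $\mathfrak g(A)$ is the Lie algebra generated by $e_i,f_i$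 ($1\le i\le\ell$) and $\mathfrak h$ with relations: $[e_i,f_j]=\delta_{ij}\alpha_i^\vee$; $[h,h']=0$ for $h,h'\in\mathfrak h$; $[h,e_i]=\alpha_i(h)e_i$, $[h,f_i]=-\alpha_i(h)f_i$; $(\operatorname{ad}e_i)^{1-a_{i,j}}e_j=(\operatorname{ad}f_i)^{1-a_{i,j}}f_j=0$ if $a_{i,i}=2$ and $i\ne j$; $[e_i,e_j]=[f_i,f_j]=0$ if $a_{i,j}=0$. $A$ is symmetrizable if there is an invertible diagonal matrix $D$ with $DA$ symmetric; $A$ is indecomposable if its Dynkin diagram (vertices $1,\dots,\ell$, $i\ne j$ joined iff $a_{i,j}\neq0$) is connected. A simple root $\alpha_i$ is called real if $a_{i,i}=2$ and imaginary if $a_{i,i}\le 0$. $B$ denotes the submatrix of $A$ with rows and columns indexed by $\{i: a_{i,i}=2\}$, and $\mathfrak g'(B)$ denotes the derived subalgebra of $\mathfrak g(B)$, identified with the Lie subalgebra of $\mathfrak g$ generated by $\{e_i,f_i: a_{i,i}=2\}$ (it is $0$ if there are no such $i$). *)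

(* Defs.v *)
From HB Require Import structures.
From mathcomp Require Import all_boot all_order all_algebra.
From mathcomp Require Import complex Rstruct.
Set Implicit Arguments. Unset Strict Implicit. Unset Printing Implicit Defensive.
Import Order.TTheory GRing.Theory Num.Theory.
Local Open Scope ring_scope.

Definition RR : rcfType := Rdefinitions.R.
Definition CC := complex RR.

Record lieAlgebra (K : fieldType) := LieAlgebra {
  lie_car :> lmodType K;
  lie_br : lie_car -> lie_car -> lie_car;
  lie_brDl : forall a (x y z : lie_car),
      lie_br (a *: x + y) z = a *: lie_br x z + lie_br y z;
  lie_brDr : forall a (x y z : lie_car),
      lie_br z (a *: x + y) = a *: lie_br z x + lie_br z y;
  lie_brxx : forall x : lie_car, lie_br x x = 0;
  lie_jacobi : forall x y z : lie_car,
      lie_br x (lie_br y z) + lie_br y (lie_br z x) + lie_br z (lie_br x y) = 0 }.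

Definition lie_hom (K : fieldType) (L M : lieAlgebra K) (phi : L -> M) :=
  (forall a (x y : L), phi (a *: x + y) = a *: phi x + phi y) /\
  (forall x y : L, phi (lie_br x y) = lie_br (phi x) (phi y)).

Definition lie_gen (K : fieldType) (L : lieAlgebra K) (S : L -> Prop) (x : L) :=
  forall P : L -> Prop,
    P 0 ->
    (forall a (u v : L), P u -> P v -> P (a *: u + v)) ->
    (forall u v : L, P u -> P v -> P (lie_br u v)) ->
    (forall u, S u -> P u) -> P x.

Definition ad_locnil (K : fieldType) (L : lieAlgebra K) (x : L) :=
  forall y : L, exists n : nat, iter n (lie_br x) y = 0.

Definition g_nil (K : fieldType) (L : lieAlgebra K) : L -> Prop :=
  lie_gen (@ad_locnil K L).

Definition gB (l : nat) (A : 'M[RR]_l) (L : lieAlgebra CC) (e f : 'I_l -> L) :=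
  lie_gen (fun x : L => exists i, A i i = 2 /\ (x = e i \/ x = f i)).

(* dim h = 2 l - rank A ; h := 'rV[CC]_(hdim A) *)
Definition hdim (l : nat) (A : 'M[RR]_l) : nat := (2 * l - \rank A)%N.

(* realization: alphav (rows = coroots alpha_i^vee in h),
   alpha (columns = roots alpha_j in h^*, alpha_j(u) = (u *m alpha) 0 j) *)
Definition is_realization (l : nat) (A : 'M[RR]_l)
    (alpha : 'M[CC]_(hdim A, l)) (alphav : 'M[CC]_(l, hdim A)) :=
  row_free alphav /\ row_free alpha^T /\
  alphav *m alpha = map_mx (fun r : RR => (Complex r 0 : CC)) A.

Definition gkm_rel (l : nat) (A : 'M[RR]_l)
    (alpha : 'M[CC]_(hdim A, l)) (alphav : 'M[CC]_(l, hdim A))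
    (L : lieAlgebra CC) (iota : 'rV[CC]_(hdim A) -> L) (e f : 'I_l -> L) :=
  (forall a (u v : 'rV[CC]_(hdim A)), iota (a *: u + v) = a *: iota u + iota v) /\
  (forall i j, lie_br (e i) (f j) = if i == j then iota (row i alphav) else 0) /\
  (forall u v, lie_br (iota u) (iota v) = 0) /\
  (forall u i, lie_br (iota u) (e i) = (u *m alpha) 0 i *: e i) /\
  (forall u i, lie_br (iota u) (f i) = - ((u *m alpha) 0 i) *: f i) /\
  (forall i j (n : nat), A i i = 2 -> i != j -> n%:R = 1 - A i j ->
      iter n (lie_br (e i)) (e j) = 0 /\ iter n (lie_br (f i)) (f j) = 0) /\
  (forall i j, A i j = 0 -> lie_br (e i) (e j) = 0 /\ lie_br (f i) (f j) = 0).

Definition is_GKM (l : nat) (A : 'M[RR]_l)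
    (alpha : 'M[CC]_(hdim A, l)) (alphav : 'M[CC]_(l, hdim A))
    (L : lieAlgebra CC) (iota : 'rV[CC]_(hdim A) -> L) (e f : 'I_l -> L) :=
  gkm_rel alpha alphav iota e f /\
  forall (M : lieAlgebra CC) (iota' : 'rV[CC]_(hdim A) -> M) (e' f' : 'I_l -> M),
    gkm_rel alpha alphav iota' e' f' ->
    (exists phi : L -> M, lie_hom phi /\ (forall u, phi (iota u) = iota' u) /\
        (forall i, phi (e i) = e' i) /\ (forall i, phi (f i) = f' i)) /\
    (forall phi1 phi2 : L -> M,
        lie_hom phi1 /\ (forall u, phi1 (iota u) = iota' u) /\
        (forall i, phi1 (e i) = e' i) /\ (forall i, phi1 (f i) = f' i) ->
        lie_hom phi2 /\ (forall u, phi2 (iota u) = iota' u) /\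
        (forall i, phi2 (e i) = e' i) /\ (forall i, phi2 (f i) = f' i) ->
        forall x, phi1 x = phi2 x).

Definition BKM_matrix (l : nat) (A : 'M[RR]_l) :=
  (forall i, A i i = 2 \/ A i i <= 0) /\
  (forall i j, i != j -> A i j <= 0) /\
  (forall i j, A i i = 2 -> exists z : int, A i j = z%:~R) /\
  (forall i j, A i j = 0 <-> A j i = 0).

Definition symmetrizable (l : nat) (A : 'M[RR]_l) :=
  exists d : 'rV[RR]_l, diag_mx d \in unitmx /\ (diag_mx d *m A)^T = diag_mx d *m A.

Definition indecomposable (l : nat) (A : 'M[RR]_l) :=
  forall i j : 'I_l, connect (fun p q : 'I_l => (p != q) && (A p q != 0)) i j.

(* Main.v *)
(** The relations of g involving an imaginary simple root alpha_i are all of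
    degree at most one in e_i and in f_i.  Hence g acts on the tensor algebra
    T(g): e_i by left multiplication, f_i by a lowering operator, and h and all
    other generators by derivations.  In the grading by the coefficient of
    alpha_i, the positive part is generated by its degree-one part V, whose
    elements act by left multiplication, and the Dynkin-Specht-Wever identity
    shows that the positive part embeds in T(g) (it is the free Lie algebra
    on V).

    If x is ad-locally nilpotent and has a nonzero component of positive degree,
    then its top component c satisfies (ad c)^k y = 0 for y = e_i and for
    y = [e_j, e_i] with j adjacent to i, which exists because A is
    indecomposable with l >= 2.  These are two independent elements of V, and in
    the tensor algebra this is impossible.  Exchanging the e's and f's excludes
    negative degrees.  So x has degree 0 for every imaginary i, and the
    triangular decomposition then places it in g'(B) + h. *)

Require Import Defs.
From HB Require Import structures.
From mathcomp Require Import all_boot all_order all_algebra.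
From mathcomp Require Import complex Rstruct.
From mathcomp Require Import boolp classical_sets functions ring zify.
Import Order.TTheory GRing.Theory Num.Theory.
Local Open Scope ring_scope.

Set Implicit Arguments. Unset Strict Implicit. Unset Printing Implicit Defensive.

#[global] Arguments lie_br : simpl never.

(** * Bracket identities and generated subalgebras *)

Section LieBasics.
Variables (K : fieldType) (L : lieAlgebra K).
Implicit Types x y z : L.

Lemma lie_br0 x : lie_br x 0 = 0.
Proof. by have := lie_brDr (-1) 0 0 x; rewrite scaler0 addr0 scaleN1r addNr. Qed.

Lemma lie_brD x y z : lie_br x (y + z) = lie_br x y + lie_br x z.
Proof. by have := lie_brDr 1 y z x; rewrite !scale1r. Qed.

Lemma lie_brZ a x y : lie_br x (a *: y) = a *: lie_br x y.
Proof. by have := lie_brDr a y 0 x; rewrite lie_br0 !addr0. Qed.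

Lemma lie_brN x y : lie_br x (- y) = - lie_br x y.
Proof. by rewrite -scaleN1r lie_brZ scaleN1r. Qed.

Lemma lie_brDL x y z : lie_br (x + y) z = lie_br x z + lie_br y z.
Proof. by have := lie_brDl 1 x y z; rewrite !scale1r. Qed.

Lemma lie_brC x y : lie_br x y = - lie_br y x.
Proof.
apply/eqP; rewrite -addr_eq0; apply/eqP.
by have := lie_brxx (x + y); rewrite lie_brDL !lie_brD !lie_brxx add0r addr0.
Qed.

Lemma lie_0br x : lie_br 0 x = 0.
Proof. by rewrite lie_brC lie_br0 oppr0. Qed.

Lemma lie_brZL a x y : lie_br (a *: x) y = a *: lie_br x y.
Proof. by rewrite lie_brC lie_brZ lie_brC scalerN opprK. Qed.

Lemma lie_brNL x y : lie_br (- x) y = - lie_br x y.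
Proof. by rewrite lie_brC lie_brN lie_brC opprK. Qed.

Lemma lie_ad x y z :
  lie_br x (lie_br y z) = lie_br (lie_br x y) z + lie_br y (lie_br x z).
Proof.
have /eqP := lie_jacobi x y z.
rewrite -addrA addr_eq0 => /eqP ->.
by rewrite opprD addrC -(lie_brC _ z) (lie_brC z x) lie_brN opprK.
Qed.

Lemma lie_adl x y z :
  lie_br (lie_br x y) z = lie_br x (lie_br y z) - lie_br y (lie_br x z).
Proof. by rewrite lie_ad addrK. Qed.

Lemma iter_br0 n x : iter n (lie_br x) 0 = 0.
Proof. by elim: n => //= n ->; rewrite lie_br0. Qed.

Lemma iter_brD n x y z :
  iter n (lie_br x) (y + z) = iter n (lie_br x) y + iter n (lie_br x) z.
Proof. by elim: n => //= n ->; rewrite lie_brD. Qed.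

Lemma iter_brZ n a x y : iter n (lie_br x) (a *: y) = a *: iter n (lie_br x) y.
Proof. by elim: n => //= n ->; rewrite lie_brZ. Qed.

Lemma iter_br_le m n x y :
  (m <= n)%N -> iter m (lie_br x) y = 0 -> iter n (lie_br x) y = 0.
Proof. by move=> /subnK <- h; rewrite iterD h iter_br0. Qed.

(** Leibniz rule: each term of the expansion applies [ad x] at least [n] times to [y] or at least
    [m] times to [z]. *)
Lemma iter_br_br N n m x y z : (n + m <= N)%N ->
  iter n (lie_br x) y = 0 -> iter m (lie_br x) z = 0 ->
  iter N (lie_br x) (lie_br y z) = 0.
Proof.
elim: N n m y z => [|N IH] n m y z.
  by rewrite leqn0 addn_eq0 => /andP[/eqP -> _] /= ->; rewrite lie_0br.
move=> le hy hz; rewrite iterSr lie_ad iter_brD.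
have -> : iter N (lie_br x) (lie_br (lie_br x y) z) = 0.
  case: n hy le => [/= -> _|n hy le]; first by rewrite lie_br0 lie_0br iter_br0.
  by apply: IH hz; [exact: le | rewrite -iterSr].
case: m hz le => [/= -> _|m hz le]; first by rewrite !lie_br0 iter_br0 addr0.
rewrite add0r; apply: (IH n m) => //; last by rewrite -iterSr.
by rewrite -ltnS -addnS.
Qed.

(** The vectors killed by some power of [ad x] form a subalgebra, so local nilpotency can be tested
    on generators. *)
Lemma lie_gen_ad_nil (S : L -> Prop) x :
  (forall y, S y -> exists n, iter n (lie_br x) y = 0) ->
  forall y, lie_gen S y -> exists n, iter n (lie_br x) y = 0.
Proof.
move=> hS y gy.
apply: (gy (fun y => exists n, iter n (lie_br x) y = 0)) => //
  [|a u v [n hu] [m hv]|u v [n hu] [m hv]].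
- by exists 0.
- exists (maxn n m); rewrite iter_brD iter_brZ.
  by rewrite (iter_br_le (leq_maxl _ _) hu) (iter_br_le (leq_maxr _ _) hv)
             scaler0 addr0.
- by exists (n + m)%N; apply: iter_br_br hu hv.
Qed.

Lemma lie_gen0 (S : L -> Prop) : lie_gen S 0.
Proof. by move=> P. Qed.

Lemma lie_gen_lin (S : L -> Prop) a u v :
  lie_gen S u -> lie_gen S v -> lie_gen S (a *: u + v).
Proof. by move=> hu hv P h0 hl hb hS; exact: hl (hu P h0 hl hb hS) (hv P h0 hl hb hS). Qed.

Lemma lie_gen_br (S : L -> Prop) u v :
  lie_gen S u -> lie_gen S v -> lie_gen S (lie_br u v).
Proof. by move=> hu hv P h0 hl hb hS; exact: hb (hu P h0 hl hb hS) (hv P h0 hl hb hS). Qed.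

Lemma lie_gen_sub (S : L -> Prop) u : S u -> lie_gen S u.
Proof. by move=> hu P h0 hl hb hS; apply: hS. Qed.

Lemma lie_gen_mono (S T : L -> Prop) u :
  (forall v, S v -> T v) -> lie_gen S u -> lie_gen T u.
Proof. by move=> ST hu P h0 hl hb hT; apply: hu => // v /ST /hT. Qed.

End LieBasics.

(** * Subspaces and subalgebras given by propositions *)

Record submod (K : fieldType) (U : lmodType K) := Submod {
  sm_mem :> U -> Prop;
  sm_0 : sm_mem 0;
  sm_lin : forall a u v, sm_mem u -> sm_mem v -> sm_mem (a *: u + v) }.

Definition sm_pred (K : fieldType) (U : lmodType K) (S : submod U) : {pred U} :=
  fun x => `[<S x>].

Section SubmodType.
Variables (K : fieldType) (U : lmodType K) (S : submod U).

Lemma sm_closed : submod_closed (sm_pred S).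
Proof.
split; first by apply/asboolP; exact: sm_0.
by move=> a u v /asboolP hu /asboolP hv; apply/asboolP; exact: sm_lin.
Qed.

HB.instance Definition _ :=
  GRing.isSubmodClosed.Build K U (sm_pred S) sm_closed.

Record sub_of := SubOf { sub_val : U; sub_valP : sm_pred S sub_val }.
HB.instance Definition _ := [isSub for sub_val].
HB.instance Definition _ := [Choice of sub_of by <:].
HB.instance Definition _ := [SubChoice_isSubLmodule of sub_of by <:].

Lemma sub_ofP (x : sub_of) : S (sub_val x).
Proof. by apply/asboolP; exact: sub_valP. Qed.

Definition mk_sub u (hu : S u) : sub_of := SubOf (introT (asboolP _) hu).

Lemma sub_inj : injective sub_val.
Proof. exact: val_inj. Qed.

Lemma sub_val_lin a (x y : sub_of) :
  sub_val (a *: x + y) = a *: sub_val x + sub_val y.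
Proof. by []. Qed.

End SubmodType.

Section Subalgebra.
Variables (K : fieldType) (L : lieAlgebra K) (S : submod L).
Hypothesis S_br : forall u v, S u -> S v -> S (lie_br u v).

Definition subalg_br (x y : sub_of S) : sub_of S :=
  mk_sub (S_br (sub_ofP x) (sub_ofP y)).

Definition subalg : lieAlgebra K.
Proof.
refine (@LieAlgebra K (sub_of S : lmodType K) subalg_br _ _ _ _).
- by move=> a x y z; apply: sub_inj; rewrite sub_val_lin /= lie_brDl.
- by move=> a x y z; apply: sub_inj; rewrite sub_val_lin /= lie_brDr.
- by move=> x; apply: sub_inj; rewrite /= lie_brxx.
- move=> x y z; apply: sub_inj.
  exact: (lie_jacobi (sub_val x) (sub_val y) (sub_val z)).
Defined.

End Subalgebra.

(** * The Lie algebra of linear endomorphisms *)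

Section Endo.
Variables (K : fieldType) (F : lmodType K).

(** Linear maps are cut out of the space of all functions, so [endo] inherits a vector space
    structure whatever the dimension of [F]. *)
Definition endo_submod : submod (F -> F : lmodType K).
Proof.
refine (@Submod K (F -> F) (fun g => forall a u v, g (a *: u + v) = a *: g u + g v) _ _).
- by move=> a u v; rewrite /= scaler0 addr0.
- move=> b g h hg hh a u v; rewrite /= !fctE.
  by rewrite hg hh !scalerDr !scalerA (mulrC a) addrACA.
Defined.

Definition endo := sub_of endo_submod.

Lemma endo_lin (g : endo) a u v :
  sub_val g (a *: u + v) = a *: sub_val g u + sub_val g v.
Proof. exact: (sub_ofP g). Qed.

Lemma endo0 (g : endo) : sub_val g 0 = 0.
Proof. by have := endo_lin g (-1) 0 0; rewrite scaler0 addr0 scaleN1r addNr. Qed.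

Lemma endoD (g : endo) u v : sub_val g (u + v) = sub_val g u + sub_val g v.
Proof. by have := endo_lin g 1 u v; rewrite !scale1r. Qed.

Lemma endoZ (g : endo) a u : sub_val g (a *: u) = a *: sub_val g u.
Proof. by have := endo_lin g a u 0; rewrite endo0 !addr0. Qed.

Lemma endoN (g : endo) u : sub_val g (- u) = - sub_val g u.
Proof. by rewrite -scaleN1r endoZ scaleN1r. Qed.

Definition opcomm_fun (g h : endo) : F -> F :=
  fun u => sub_val h (sub_val g u) - sub_val g (sub_val h u).

Lemma opcomm_funP g h : endo_submod (opcomm_fun g h).
Proof.
move=> a u v; rewrite /opcomm_fun !endo_lin scalerBr opprD addrACA //.
Qed.

Definition opcomm (g h : endo) : endo := mk_sub (opcomm_funP g h).

(* The commutator is reversed, so that homomorphisms to [glop F] are right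
   module structures on [F]. *)
Definition glop : lieAlgebra K.
Proof.
refine (@LieAlgebra K (endo : lmodType K) opcomm _ _ _ _).
- move=> a x y z; apply: sub_inj; apply: funext => u.
  rewrite sub_val_lin /= /opcomm_fun sub_val_lin !fctE endoD endoZ.
  by rewrite scalerBr opprD addrACA.
- move=> a x y z; apply: sub_inj; apply: funext => u.
  rewrite sub_val_lin /= /opcomm_fun sub_val_lin !fctE endoD endoZ.
  by rewrite scalerBr opprD addrACA.
- by move=> x; apply: sub_inj; apply: funext => u; rewrite /= /opcomm_fun subrr.
- move=> x y z; apply: sub_inj; apply: funext => u /=.
  rewrite !fctE /opcomm_fun /= /opcomm_fun !(endoD, endoN) !opprD !opprK.
  (* The Jacobi sum has twelve terms: each of the six composites occurs once with each sign. *)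
  set xyz := sub_val x (sub_val y (sub_val z u)).
  set xzy := sub_val x (sub_val z (sub_val y u)).
  set yxz := sub_val y (sub_val x (sub_val z u)).
  set yzx := sub_val y (sub_val z (sub_val x u)).
  set zxy := sub_val z (sub_val x (sub_val y u)).
  set zyx := sub_val z (sub_val y (sub_val x u)).
  suff H (a b c d p q : F) :
    a - b + (- c + d) + (c - p + (- q + b)) + (q - d + (- a + p)) = 0 by exact: H.
  rewrite !addrA (ACl ((1*11)*(8*2)*(5*3)*(4*10)*(12*6)*(9*7)))/=.
  by rewrite !subrr !addr0.
Defined.

Lemma glop_brE (g h : glop) u : sub_val (lie_br g h : endo) u =
  sub_val (h : endo) (sub_val (g : endo) u) - sub_val (g : endo) (sub_val (h : endo) u).
Proof. reflexivity. Qed.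

Lemma glop_linE c (g h : glop) u : sub_val (c *: g + h : endo) u =
  c *: sub_val (g : endo) u + sub_val (h : endo) u.
Proof. reflexivity. Qed.

Lemma glop_0E u : sub_val (0 : glop) u = 0.
Proof. reflexivity. Qed.

End Endo.

(** * Linear functionals *)

Section Functionals.
Variables (K : fieldType) (U : lmodType K).

Definition is_functional (f : U -> K) :=
  forall a u v, f (a *: u + v) = a * f u + f v.

(** By Zorn there is a maximal subspace [A] that contains [S] and avoids [x]. It is a complement of
    the line through [x], and the functional is the coordinate along [x]. *)
Lemma functional_ex (S : submod U) (x : U) : ~ S x ->
  exists f : U -> K, [/\ is_functional f, f x = 1 & forall u, S u -> f u = 0].
Proof.
move=> Sx.
(* Containment of [S] is required only of nonempty sets, because the union of the empty chain must
   also satisfy [P]. *)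
pose P (A : set U) := [/\ forall w u, A w -> S u -> A u, ~ A x &
  forall a u v, A u -> A v -> A (a *: u + v)].
have [F FP Ftot|A [[AS Ax Alin] Amax]] := @Zorn_bigcup U P.
  split=> [w u [X FX Xw] Su|[X FX Xx]|a u v [X FX Xu] [Y FY Yv]].
  - by exists X => //; have [h _ _] := FP _ FX; apply: h Xw Su.
  - by have [_ h _] := FP _ FX.
  - have [XY|YX] := Ftot _ _ FX FY.
      by exists Y => //; have [_ _ h] := FP _ FY; apply: h => //; exact: XY.
    by exists X => //; have [_ _ h] := FP _ FX; apply: h => //; exact: YX.
(* Otherwise [A] is empty and [S] itself is strictly larger. *)
have SA u : S u -> A u.
  move=> Su; apply: contrapT => nAu.
  apply: (Amax (sm_mem S)); last by split=> // [a v w]; exact: sm_lin.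
  split=> [|/(_ _ Su)//] w Aw; exfalso; apply: nAu; exact: AS Aw Su.
have A0 : A 0 by apply: SA; exact: sm_0.
have AZ a u : A u -> A (a *: u) by move=> Au; rewrite -[_ *: _]addr0; exact: Alin.
(* Otherwise the sum of [A] and the line through [z] still avoids [x], against maximality. *)
have Ex z : exists c, A (z - c *: x).
  apply: contrapT => nz.
  have nP := Amax (fun w => exists t, A (w - t *: z)); apply: nP.
    split=> [w Aw|h]; first by exists 0; rewrite scale0r subr0.
    apply: nz; exists 0; rewrite scale0r subr0; apply: h.
    by exists 1; rewrite scale1r subrr.
  split=> [w u _ /SA Au|[t At]|a u v [t At] [s As]].
  - by exists 0; rewrite scale0r subr0.
  - have [t0|t0] := eqVneq t 0; first by move: At; rewrite t0 scale0r subr0.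
    apply: nz; exists t^-1; have := AZ (- t^-1) _ At.
    by rewrite scalerBr scalerA mulNr mulVf // !scaleNr scale1r opprK addrC.
  - exists (a * t + s).
    have -> : a *: u + v - (a * t + s) *: z = a *: (u - t *: z) + (v - s *: z).
      by rewrite scalerBr scalerDl scalerA opprD addrACA.
    exact: Alin.
have uniq z c c' : A (z - c *: x) -> A (z - c' *: x) -> c = c'.
  move=> h h'; apply/eqP; rewrite -subr_eq0; apply/negPn/negP => n0.
  apply: Ax; have := AZ (c - c')^-1 _ (Alin (-1) _ _ h h').
  rewrite scaleN1r opprB addrA subrK -scalerBl scalerA mulVf // scale1r //.
exists (fun z => projT1 (cid (Ex z))); split.
- move=> a u v; apply: (uniq (a *: u + v)); first exact: projT2 (cid (Ex _)).
  have hu := projT2 (cid (Ex u)); have hv := projT2 (cid (Ex v)).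
  have := Alin a _ _ hu hv.
  by rewrite scalerBr scalerA addrACA -opprD -scalerDl.
- apply: (uniq x); first exact: projT2 (cid (Ex _)).
  by rewrite scale1r subrr.
- move=> u /SA Au; apply: (uniq u); first exact: projT2 (cid (Ex _)).
  by rewrite scale0r subr0.
Qed.

(** With [y = 0] this gives a functional that does not vanish at a given nonzero [x]. *)
Lemma functional_sep (x y : U) : (forall a, x <> a *: y) ->
  exists f : U -> K, [/\ is_functional f, f x = 1 & f y = 0].
Proof.
move=> xy; pose line u := exists a, u = a *: y.
have line0 : line 0 by exists 0; rewrite scale0r.
have line_lin a u v : line u -> line v -> line (a *: u + v).
  move=> [b ->] [c ->]; exists (a * b + c).
  by rewrite scalerDl scalerA.
have [|f [fl fx fy]] := @functional_ex (Submod line0 line_lin) x.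
  by move=> [a /xy].
by exists f; split=> //; apply: fy; exists 1; rewrite scale1r.
Qed.

End Functionals.

(** * Operators on multilinear forms *)

Section Multilinear.
Variables (K : fieldType) (L : lieAlgebra K).
Implicit Types (phi psi : seq L -> K^o) (s t : seq L) (a b x y v : L).

Definition multilin phi := forall s t c u v,
  phi (s ++ (c *: u + v) :: t) = c * phi (s ++ u :: t) + phi (s ++ v :: t).

Definition mcons v phi : seq L -> K^o := fun s => phi (v :: s).

(* A form on words in [L] is a functional on the tensor algebra, which carries
   left multiplication by [v] (transpose: [mcons v]), the derivation extending
   [ad x] (transpose: [der x]) and the operator killing the empty word with
   [y (v s) = [y, v] s + v (y s)], where [[y, v]] acts as a derivation
   (transpose: [low y]). *)
Fixpoint der x phi s : K^o :=
  if s is v :: s' then phi (lie_br x v :: s') + der x (mcons v phi) s' else 0.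

Fixpoint low y phi s : K^o :=
  if s is v :: s' then der (lie_br y v) phi s' + low y (mcons v phi) s' else 0.

Lemma multilin_mcons v phi : multilin phi -> multilin (mcons v phi).
Proof. by move=> h s t c u w; have := h (v :: s) t c u w. Qed.

Lemma multilin_head phi c u v s : multilin phi ->
  phi ((c *: u + v) :: s) = c * phi (u :: s) + phi (v :: s).
Proof. by move=> h; apply: (h [::]). Qed.

Lemma der_phi_lin x c phi psi s :
  der x (c *: phi + psi) s = c * der x phi s + der x psi s.
Proof.
elim: s phi psi => [|v s IH] phi psi /=; first by rewrite mulr0 addr0.
rewrite /mcons /= (IH (mcons v phi) (mcons v psi)) !fctE /=.
by rewrite mulrDr addrACA.
Qed.

Lemma low_phi_lin y c phi psi s :
  low y (c *: phi + psi) s = c * low y phi s + low y psi s.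
Proof.
elim: s phi psi => [|v s IH] phi psi /=; first by rewrite mulr0 addr0.
rewrite (IH (mcons v phi) (mcons v psi)) der_phi_lin.
by rewrite mulrDr addrACA.
Qed.

Lemma mcons_lin c u v phi : multilin phi ->
  mcons (c *: u + v) phi = c *: mcons u phi + mcons v phi.
Proof. by move=> h; apply: funext => s; rewrite /mcons multilin_head. Qed.

Lemma der_lin c x y phi s : multilin phi ->
  der (c *: x + y) phi s = c * der x phi s + der y phi s.
Proof.
elim: s phi => [|v s IH] phi h /=; first by rewrite mulr0 addr0.
rewrite IH; last exact: multilin_mcons.
by rewrite lie_brDl multilin_head // mulrDr addrACA.
Qed.

Lemma der0 phi s : multilin phi -> der 0 phi s = 0.
Proof.
move=> h; have := der_lin (-1) 0 0 s h.
by rewrite scaler0 addr0 mulN1r addNr.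
Qed.

Lemma multilin0 phi s : multilin phi -> phi (0 :: s) = 0.
Proof.
move=> h; have := multilin_head (-1) 0 0 s h.
by rewrite scaler0 addr0 mulN1r addNr.
Qed.

Lemma multilinB phi u v s : multilin phi ->
  phi ((u - v) :: s) = phi (u :: s) - phi (v :: s).
Proof. by move=> h; rewrite addrC -scaleN1r multilin_head // mulN1r addrC. Qed.

Lemma derB x y phi s : multilin phi ->
  der (x - y) phi s = der x phi s - der y phi s.
Proof. by move=> h; rewrite addrC -scaleN1r der_lin // mulN1r addrC. Qed.

Lemma multilin_der x phi : multilin phi -> multilin (der x phi).
Proof.
move=> h s t c u v; elim: s phi h => [|w s IH] phi h /=.
  rewrite mcons_lin // der_phi_lin lie_brDr multilin_head //.
  by rewrite mulrDr addrACA.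
rewrite IH; last exact: multilin_mcons.
have := h (lie_br x w :: s) t c u v => /= ->.
by rewrite mulrDr addrACA.
Qed.

Lemma multilin_low y phi : multilin phi -> multilin (low y phi).
Proof.
move=> h s t c u v; elim: s phi h => [|w s IH] phi h /=.
  rewrite mcons_lin // low_phi_lin lie_brDr der_lin //.
  by rewrite mulrDr addrACA.
rewrite IH; last exact: multilin_mcons.
by rewrite multilin_der // mulrDr addrACA.
Qed.

Lemma low_lin c x y phi s : multilin phi ->
  low (c *: x + y) phi s = c * low x phi s + low y phi s.
Proof.
elim: s phi => [|v s IH] phi h /=; first by rewrite mulr0 addr0.
rewrite IH; last exact: multilin_mcons.
by rewrite lie_brDl der_lin // mulrDr addrACA.
Qed.

Lemma low0 phi s : multilin phi -> low 0 phi s = 0.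
Proof.
move=> h; have := low_lin (-1) 0 0 s h.
by rewrite scaler0 addr0 mulN1r addNr.
Qed.

(** Transposition reverses composition, hence the order on the right; this agrees with the
    convention of [glop]. *)
Lemma der_br a b phi s : multilin phi ->
  der (lie_br a b) phi s = der b (der a phi) s - der a (der b phi) s.
Proof.
elim: s phi => [|v s IH] phi h /=; first by rewrite subr0.
have mE x : mcons v (der x phi) = mcons (lie_br x v) phi + der x (mcons v phi).
  by apply: funext.
rewrite !mE -[mcons _ phi + _]scale1r -[mcons (lie_br b v) _]scale1r.
have E x y : der x (mcons (lie_br y v) phi + der y (mcons v phi)) s
   = der x (mcons (lie_br y v) phi) s + der x (der y (mcons v phi)) s.
  by have := der_phi_lin x 1 (mcons (lie_br y v) phi) (der y (mcons v phi)) s;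
     rewrite scale1r mul1r.
rewrite !scale1r !E IH; last exact: multilin_mcons.
rewrite lie_adl multilinB //.
rewrite /mcons /=; ring.
Qed.

Lemma mcons_br a v phi s :
  mcons (lie_br a v) phi s = mcons v (der a phi) s - der a (mcons v phi) s.
Proof. by rewrite /mcons /= addrK. Qed.

Lemma der_low_br y v phi s :
  der (lie_br y v) phi s = mcons v (low y phi) s - low y (mcons v phi) s.
Proof. by rewrite /mcons /= addrK. Qed.

(** The operators [low y] transform under derivations as [y] does. The induction step is the Jacobi
    identity for [a], [y] and the first letter, combined with [der_br]. *)
Lemma low_br a y phi s : multilin phi ->
  low (lie_br a y) phi s = low y (der a phi) s - der a (low y phi) s.
Proof.
elim: s phi => [|v s IH] phi h /=; first by rewrite subr0.
have mE : mcons v (der a phi) = mcons (lie_br a v) phi + der a (mcons v phi).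
  by apply: funext.
have mE' : mcons v (low y phi) = der (lie_br y v) phi + low y (mcons v phi).
  by apply: funext.
have E1 phi1 phi2 : low y (phi1 + phi2) s = low y phi1 s + low y phi2 s.
  by have := low_phi_lin y 1 phi1 phi2 s; rewrite scale1r mul1r.
have E2 phi1 phi2 : der a (phi1 + phi2) s = der a phi1 s + der a phi2 s.
  by have := der_phi_lin a 1 phi1 phi2 s; rewrite scale1r mul1r.
rewrite mE mE' E1 E2 IH; last exact: multilin_mcons.
rewrite lie_adl derB // der_br //; ring.
Qed.

Definition mform_submod : submod (seq L -> K^o : lmodType K).
Proof.
refine (@Submod K (seq L -> K^o) multilin _ _).
- by move=> s t c u v; rewrite mulr0 addr0.
- move=> b g h hg hh s t c u v; rewrite !fctE hg hh /GRing.scale /=; ring.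
Defined.

Definition mform := sub_of mform_submod.

Definition mform_eval (f : mform) : seq L -> K^o := sub_val f.

Lemma mformP (f : mform) : multilin (mform_eval f).
Proof. exact: (sub_ofP f). Qed.

Definition mk_form phi (h : multilin phi) : mform := @mk_sub _ _ mform_submod phi h.

Lemma mform_inj (f g : mform) : (forall s, mform_eval f s = mform_eval g s) -> f = g.
Proof. by move=> h; apply: sub_inj; apply: funext. Qed.

Lemma mform_lin c (f g : mform) s : mform_eval (c *: f + g) s = c * mform_eval f s + mform_eval g s.
Proof. by []. Qed.

Lemma mform0 s : mform_eval 0 s = 0.
Proof. by []. Qed.

Lemma mformZ c (f : mform) s : mform_eval (c *: f) s = c * mform_eval f s.
Proof. by []. Qed.

Lemma mformB (f g : mform) s : mform_eval (f - g) s = mform_eval f s - mform_eval g s.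
Proof. by []. Qed.

Definition mform_lie : lieAlgebra K := glop mform.

Definition mform_op (g : mform_lie) (f : mform) : mform := sub_val (g : endo mform) f.

Lemma mform_br (g h : mform_lie) f s : mform_eval (mform_op (lie_br g h) f) s =
  mform_eval (mform_op h (mform_op g f)) s - mform_eval (mform_op g (mform_op h f)) s.
Proof. by rewrite /mform_op glop_brE mformB. Qed.

Lemma mform_op_lin c (g h : mform_lie) f s : mform_eval (mform_op (c *: g + h) f) s =
  c * mform_eval (mform_op g f) s + mform_eval (mform_op h f) s.
Proof. by rewrite /mform_op glop_linE mform_lin. Qed.

Lemma mform_op0 f s : mform_eval (mform_op 0 f) s = 0.
Proof. by rewrite /mform_op glop_0E. Qed.

Lemma op_eqP (g h : mform_lie) :
  (forall f s, mform_eval (mform_op g f) s = mform_eval (mform_op h f) s) -> g = h.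
Proof.
by move=> gh; apply: sub_inj; apply: funext => f; apply: mform_inj => s; exact: gh.
Qed.

Section Op.
Variable op : (seq L -> K^o) -> (seq L -> K^o).
Hypothesis op_lin : forall c phi psi s, op (c *: phi + psi) s = c * op phi s + op psi s.
Hypothesis op_multi : forall phi, multilin phi -> multilin (op phi).

Definition op_fun (f : mform) : mform := mk_form (op_multi (mformP f)).

Lemma op_funP : endo_submod mform op_fun.
Proof. by move=> c f g; apply: mform_inj => s; rewrite mform_lin /mform_eval /= op_lin. Qed.

Definition mk_op : mform_lie := mk_sub op_funP.

Lemma mk_opE f s : mform_eval (mform_op mk_op f) s = op (mform_eval f) s.
Proof. by []. Qed.

End Op.

Lemma mcons_phi_lin v c phi psi s :
  mcons v (c *: phi + psi) s = c * mcons v phi s + mcons v psi s.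
Proof. by []. Qed.

Definition lop v : mform_lie :=
  mk_op (@mcons_phi_lin v) (@multilin_mcons v).
Definition dop x : mform_lie := mk_op (@der_phi_lin x) (@multilin_der x).
Definition rop y : mform_lie := mk_op (@low_phi_lin y) (@multilin_low y).

Lemma dop_lin c x y : dop (c *: x + y) = c *: dop x + dop y.
Proof.
by apply: op_eqP => f s; rewrite mform_op_lin !mk_opE der_lin //; exact: mformP.
Qed.

Lemma dop0 : dop 0 = 0.
Proof.
by apply: op_eqP => f s; rewrite mform_op0 mk_opE der0 //; exact: mformP.
Qed.

Lemma lop_lin c x y : lop (c *: x + y) = c *: lop x + lop y.
Proof.
apply: op_eqP => f s; rewrite mform_op_lin !mk_opE.
by apply: multilin_head; exact: mformP.
Qed.

Lemma lop0 : lop 0 = 0.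
Proof.
by apply: op_eqP => f s; rewrite mform_op0 mk_opE; apply: multilin0; exact: mformP.
Qed.

Lemma rop_lin c x y : rop (c *: x + y) = c *: rop x + rop y.
Proof.
by apply: op_eqP => f s; rewrite mform_op_lin !mk_opE low_lin //; exact: mformP.
Qed.

Lemma rop0 : rop 0 = 0.
Proof.
by apply: op_eqP => f s; rewrite mform_op0 mk_opE low0 //; exact: mformP.
Qed.

Lemma dopN x : dop (- x) = - dop x.
Proof.
by rewrite -[- x]addr0 -scaleN1r dop_lin dop0 addr0 scaleN1r.
Qed.

(** This and the next three commutators mirror brackets of [L]. Two [lop], or two [rop], satisfy no
    such rule: this leaves room for a free Lie algebra. *)
Lemma dop_br a b : lie_br (dop a) (dop b) = dop (lie_br a b).
Proof.
by apply: op_eqP => f s; rewrite mform_br !mk_opE /= der_br //; exact: mformP.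
Qed.

Lemma dop_lop a v : lie_br (dop a) (lop v) = lop (lie_br a v).
Proof. by apply: op_eqP => f s; rewrite mform_br !mk_opE /= mcons_br. Qed.

Lemma rop_lop y v : lie_br (rop y) (lop v) = dop (lie_br y v).
Proof. by apply: op_eqP => f s; rewrite mform_br !mk_opE /= der_low_br. Qed.

Lemma dop_rop a y : lie_br (dop a) (rop y) = rop (lie_br a y).
Proof.
by apply: op_eqP => f s; rewrite mform_br !mk_opE /= low_br //; exact: mformP.
Qed.

End Multilinear.

(** * The action of a generalized Kac-Moody algebra on forms *)

Definition gkm_gens (l n : nat) (L : lieAlgebra CC) (iota : 'rV[CC]_n -> L)
    (e f : 'I_l -> L) (x : L) :=
  (exists u, x = iota u) \/ (exists i, x = e i \/ x = f i).

Section Universal.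
Variables (l : nat) (A : 'M[RR]_l).
Variables (alpha : 'M[CC]_(hdim A, l)) (alphav : 'M[CC]_(l, hdim A)).
Variables (L : lieAlgebra CC) (iota : 'rV[CC]_(hdim A) -> L) (e f : 'I_l -> L).

(** The universal map into the subalgebra generated by the generators, followed by the inclusion, is
    the identity by uniqueness. *)
Lemma gkm_generated : is_GKM alpha alphav iota e f ->
  forall x : L, lie_gen (gkm_gens iota e f) x.
Proof.
move=> [[Hlin [Hef [Hhh [Hhe [Hhf [Hserre Hcom]]]]]] Huniv] x.
pose S := Submod (lie_gen0 (S := gkm_gens iota e f))
  (fun a u v => @lie_gen_lin _ _ _ a u v).
pose M : lieAlgebra CC := @subalg CC L S (fun u v => @lie_gen_br _ _ _ u v).
have gi u : S (iota u) by apply: lie_gen_sub; left; exists u.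
have ge i : S (e i) by apply: lie_gen_sub; right; exists i; left.
have gf i : S (f i) by apply: lie_gen_sub; right; exists i; right.
pose iota' u : M := mk_sub (gi u).
pose e' i : M := mk_sub (ge i).
pose f' i : M := mk_sub (gf i).
pose V : M -> L := @sub_val _ _ S.
have V_inj : injective V by exact: sub_inj.
have Vlin a (u v : M) : V (a *: u + v) = a *: V u + V v by [].
have VZ a (u : M) : V (a *: u) = a *: V u by [].
have V0 : V 0 = 0 by [].
have Vbr (u v : M) : V (lie_br u v) = lie_br (V u) (V v) by [].
have Vit n (u v : M) : V (iter n (lie_br u) v) = iter n (lie_br (V u)) (V v).
  by elim: n => //= n IH; rewrite -IH.
have Vi u : V (iota' u) = iota u by [].
have Ve i : V (e' i) = e i by [].
have Vf i : V (f' i) = f i by [].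
have rel' : gkm_rel alpha alphav iota' e' f'.
  split; first by move=> a u v; apply: V_inj; rewrite Vlin !Vi Hlin.
  split; first by move=> i j; apply: V_inj; rewrite Vbr Ve Vf Hef; case: (i == j).
  split; first by move=> u v; apply: V_inj; rewrite Vbr !Vi Hhh V0.
  split; first by move=> u i; apply: V_inj; rewrite Vbr VZ Vi Ve Hhe.
  split; first by move=> u i; apply: V_inj; rewrite Vbr VZ Vi Vf Hhf.
  split.
    move=> i j n Aii ij nE; have [h1 h2] := Hserre i j n Aii ij nE.
    by split; apply: V_inj; rewrite Vit ?Ve ?Vf V0.
  move=> i j Aij; have [h1 h2] := Hcom i j Aij.
  by split; apply: V_inj; rewrite Vbr ?Ve ?Vf V0.
have [[phi [[phil phib] [phii [phie phif]]]] _] := Huniv _ _ _ _ rel'.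
have relL : gkm_rel alpha alphav iota e f by do !split => //.
have [_ /(_ (fun x => x) (V \o phi)) uniq] := Huniv _ _ _ _ relL.
rewrite [x]uniq; first exact: (sub_ofP (phi x)).
- by do !split.
- split; first by split=> [a u v|u v] /=; rewrite ?phil ?phib.
  by split=> [u|] /=; [rewrite phii | split=> i /=; rewrite ?phie ?phif].
Qed.

(** The Chevalley involution, as a change of generators. It turns statements on positive degrees
    into statements on negative ones. *)
Lemma gkm_rel_opp :
  gkm_rel alpha alphav iota e f -> gkm_rel alpha alphav (fun u => - iota u) f e.
Proof.
move=> [Hlin [Hef [Hhh [Hhe [Hhf [Hserre Hcom]]]]]].
split; first by move=> a u v; rewrite Hlin opprD scalerN.
split; first by move=> i j; rewrite lie_brC Hef eq_sym; case: eqP => [->|_]; rewrite ?oppr0.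
split; first by move=> u v; rewrite lie_brN lie_brNL Hhh !oppr0.
split; first by move=> u i; rewrite lie_brNL Hhf scaleNr opprK.
split; first by move=> u i; rewrite lie_brNL Hhe scaleNr.
split; first by move=> i j n Aii ij nE; have [h1 h2] := Hserre i j n Aii ij nE.
by move=> i j Aij; have [h1 h2] := Hcom i j Aij.
Qed.

End Universal.

Lemma is_GKM_opp (l : nat) (A : 'M[RR]_l)
    (alpha : 'M[CC]_(hdim A, l)) (alphav : 'M[CC]_(l, hdim A))
    (L : lieAlgebra CC) (iota : 'rV[CC]_(hdim A) -> L) (e f : 'I_l -> L) :
  is_GKM alpha alphav iota e f -> is_GKM alpha alphav (fun u => - iota u) f e.
Proof.
move=> [rel univ]; split; first exact: gkm_rel_opp.
move=> M iota' e' f' /gkm_rel_opp rel'.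
have [[phi [phih [phii [phie phif]]]] uniq] := univ _ _ _ _ rel'.
have homN (psi : L -> M) u : lie_hom psi -> psi (- u) = - psi u.
  move=> [h _]; have h0 : psi 0 = 0.
    by have := h (-1) 0 0; rewrite scaler0 addr0 scaleN1r addNr.
  by have := h (-1) u 0; rewrite h0 !addr0 !scaleN1r.
split; first by exists phi; split=> //; split=> // u; rewrite homN // phii opprK.
move=> p1 p2 [h1 [i1 [f1 e1]]] [h2 [i2 [f2 e2]]]; apply: uniq; split=> //; split=> // u.
  by rewrite -[LHS]opprK -homN // i1.
by rewrite -[LHS]opprK -homN // i2.
Qed.

Section Action.
Variables (l : nat) (A : 'M[RR]_l).
Variables (alpha : 'M[CC]_(hdim A, l)) (alphav : 'M[CC]_(l, hdim A)).
Variables (L : lieAlgebra CC) (iota : 'rV[CC]_(hdim A) -> L) (e f : 'I_l -> L).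
Hypothesis hg : is_GKM alpha alphav iota e f.
Variable i : 'I_l.
Hypothesis Aii : A i i != 2.

Let e' j : mform_lie L := if j == i then lop (e i) else dop (e j).
Let f' j : mform_lie L := if j == i then rop (f i) else dop (f j).
Let iota' u : mform_lie L := dop (iota u).

Lemma glop_rel : gkm_rel alpha alphav iota' e' f'.
Proof.
have [[Hlin [Hef [Hhh [Hhe [Hhf [Hserre Hcom]]]]]] _] := hg.
have dopZ c (x : L) : dop (c *: x) = c *: dop x.
  by rewrite -[c *: x]addr0 dop_lin dop0 addr0.
have lopZ c (x : L) : lop (c *: x) = c *: lop x.
  by rewrite -[c *: x]addr0 lop_lin lop0 addr0.
have ropZ c (x : L) : rop (c *: x) = c *: rop x.
  by rewrite -[c *: x]addr0 rop_lin rop0 addr0.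
have Hfe j k : lie_br (f j) (e k) = if j == k then - iota (row j alphav) else 0.
  by rewrite lie_brC Hef eq_sym; case: eqP => [->|_]; rewrite ?oppr0.
have itd n (x y : L) : iter n (lie_br (dop x)) (dop y) = dop (iter n (lie_br x) y).
  by elim: n => //= n ->; rewrite dop_br.
have itl n (x y : L) : iter n (lie_br (dop x)) (lop y) = lop (iter n (lie_br x) y).
  by elim: n => //= n ->; rewrite dop_lop.
have itr n (x y : L) : iter n (lie_br (dop x)) (rop y) = rop (iter n (lie_br x) y).
  by elim: n => //= n ->; rewrite dop_rop.
rewrite /e' /f' /iota'.
split; first by move=> a u v; rewrite Hlin dop_lin.
split.
  move=> j k; case: (eqVneq j i) => [ji|ji]; case: (eqVneq k i) => [ki|ki].
  - rewrite ji ki eqxx lie_brC rop_lop Hfe eqxx.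
    by rewrite dopN opprK.
  - by rewrite ji eq_sym (negbTE ki) lie_brC dop_lop Hfe (negbTE ki) lop0 oppr0.
  - by rewrite ki (negbTE ji) dop_rop Hef (negbTE ji) rop0.
  - by rewrite dop_br Hef; case: eqP => // _; rewrite dop0.
split; first by move=> u v; rewrite dop_br Hhh dop0.
split; first by move=> u j; case: eqP => [->|_]; rewrite ?dop_lop ?dop_br Hhe ?lopZ ?dopZ.
split; first by move=> u j; case: eqP => [->|_]; rewrite ?dop_rop ?dop_br Hhf ?ropZ ?dopZ.
split.
  move=> j k n Ajj jk nE; have [h1 h2] := Hserre j k n Ajj jk nE.
  (* Serre relations iterate only generators with diagonal entry 2, never [e i] or [f i], so at most
     one factor is not a derivation. *)
  have -> : (j == i) = false by apply: contraNF Aii => /eqP <-; rewrite Ajj.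
  case: eqP => [ki|_]; last by rewrite !itd h1 h2 dop0.
  by rewrite itl itr -ki h1 h2 lop0 rop0.
move=> j k Ajk; have [h1 h2] := Hcom j k Ajk.
have [ji|ji] := eqVneq j i; have [ki|ki] := eqVneq k i.
(* The only relation with two factors of index [i] of the same kind is the bracket of a generator
   with itself. *)
- by rewrite !lie_brxx.
- rewrite (lie_brC (lop _)) (lie_brC (rop _)) dop_lop dop_rop -ji.
  by rewrite (lie_brC (e k)) (lie_brC (f k)) h1 h2 oppr0 lop0 rop0 oppr0.
- by rewrite -ki dop_lop dop_rop h1 h2 lop0 rop0.
- by rewrite !dop_br h1 h2 dop0.
Qed.

Lemma form_action : exists act : L -> mform L -> mform L,
  [/\ forall c x y phi s,
        mform_eval (act (c *: x + y) phi) s =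
          c * mform_eval (act x phi) s + mform_eval (act y phi) s,
      forall x c phi psi, act x (c *: phi + psi) = c *: act x phi + act x psi,
      forall x y phi s, mform_eval (act (lie_br x y) phi) s =
        mform_eval (act y (act x phi)) s - mform_eval (act x (act y phi)) s
    & (forall phi s, mform_eval (act (e i) phi) s = mform_eval phi (e i :: s)) /\
      forall j phi s, j != i -> mform_eval (act (e j) phi) s = der (e j) (mform_eval phi) s].
Proof.
have [_ /(_ _ _ _ _ glop_rel) [[rho [[rhol rhob] [_ [rhoe _]]]] _]] := hg.
exists (fun x => mform_op (rho x)); split.
- by move=> c x y phi s; rewrite rhol mform_op_lin.
- by move=> x c phi psi; rewrite /mform_op endo_lin.
- by move=> x y phi s; rewrite rhob mform_br.
split; first by move=> phi s; rewrite rhoe /e' eqxx.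
by move=> j phi s ji; rewrite rhoe /e' (negbTE ji).
Qed.

End Action.

(** * Generalized eigenvectors and the triangular decomposition *)

Section Eigen.
Variables (L : lieAlgebra CC) (d : L).
Implicit Types (w u v c : L) (z m : int) (zs : seq int) (Q : pred int).

Definition eigen_step z u := lie_br d u - z%:~R *: u.

(* [(ad d - z_1) ... (ad d - z_n) w] *)
Definition eigen_kill zs w := foldr eigen_step w zs.

(** This stands in for a sum of eigenvectors with eigenvalues in [Q], without carrying the summands:
    sums are handled by concatenating lists. *)
Definition gen_eigen Q w := exists zs, all Q zs /\ eigen_kill zs w = 0.

Lemma eigen_step_lin z a u v :
  eigen_step z (a *: u + v) = a *: eigen_step z u + eigen_step z v.
Proof.
rewrite /eigen_step lie_brDr scalerDr !scalerBr !scalerA (mulrC _ a).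
by rewrite opprD addrACA.
Qed.

Lemma eigen_kill_lin zs a u v :
  eigen_kill zs (a *: u + v) = a *: eigen_kill zs u + eigen_kill zs v.
Proof. by elim: zs => //= z zs ->; rewrite eigen_step_lin. Qed.

Lemma eigen_kill0 zs : eigen_kill zs 0 = 0.
Proof.
by elim: zs => //= z zs ->; rewrite /eigen_step lie_br0 scaler0 subr0.
Qed.

Lemma eigen_stepC z m u :
  eigen_step z (eigen_step m u) = eigen_step m (eigen_step z u).
Proof.
rewrite /eigen_step !lie_brD !lie_brN !lie_brZ !scalerBr !scalerA (mulrC m%:~R).
by rewrite !opprB !addrA [RHS](ACl (1*4*3*2)).
Qed.

Lemma eigen_kill_step zs z u :
  eigen_kill zs (eigen_step z u) = eigen_step z (eigen_kill zs u).
Proof. by elim: zs => //= m zs ->; rewrite eigen_stepC. Qed.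

Lemma eigen_killC zs ms u :
  eigen_kill zs (eigen_kill ms u) = eigen_kill ms (eigen_kill zs u).
Proof. by elim: ms => //= m ms <-; rewrite eigen_kill_step. Qed.

Lemma gen_eigen_lin Q a u v :
  gen_eigen Q u -> gen_eigen Q v -> gen_eigen Q (a *: u + v).
Proof.
move=> [zs [hz uz]] [ms [hm vm]]; exists (zs ++ ms).
rewrite all_cat hz hm /eigen_kill foldr_cat -/(eigen_kill ms _) -/(eigen_kill zs _).
by rewrite !eigen_kill_lin vm eigen_killC uz !eigen_kill0 scaler0 addr0.
Qed.

Lemma gen_eigen_add Q u v : gen_eigen Q u -> gen_eigen Q v -> gen_eigen Q (u + v).
Proof. by move=> hu hv; rewrite -[u]scale1r; apply: gen_eigen_lin. Qed.

Lemma gen_eigen_hom Q z u : lie_br d u = z%:~R *: u -> Q z -> gen_eigen Q u.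
Proof. by move=> hu Qz; exists [:: z]; rewrite /= Qz /eigen_step hu subrr. Qed.

Lemma gen_eigen_mono Q Q' u :
  (forall z, Q z -> Q' z) -> gen_eigen Q u -> gen_eigen Q' u.
Proof. by move=> QQ' [zs [hz uz]]; exists zs; split=> //; apply: sub_all hz. Qed.

Lemma gen_eigen_disj Q Q' u : (forall z, Q z -> ~~ Q' z) ->
  gen_eigen Q u -> gen_eigen Q' u -> u = 0.
Proof.
move=> QQ' [zs []]; elim: zs => //= z zs IH /andP[Qz Qzs] hu [ms [hm um]].
apply: IH => //; last by exists ms.
have hm' : eigen_kill ms (eigen_kill zs u) = 0 by rewrite eigen_killC um eigen_kill0.
have nz : z \notin ms by apply/negP => /(allP hm); apply/negP; exact: QQ'.
have du : lie_br d (eigen_kill zs u) = z%:~R *: eigen_kill zs u.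
  by apply/eqP; rewrite -subr_eq0; apply/eqP.
move: (eigen_kill zs u) du hm' => w dw.
elim: ms nz {hm um} => //= m ms IHm; rewrite in_cons negb_or => /andP[zm nz].
rewrite -eigen_kill_step /eigen_step dw -scalerBl.
rewrite -[_ *: w]addr0 eigen_kill_lin eigen_kill0 addr0 => /eqP.
rewrite scaler_eq0 subr_eq0 eqr_int (negbTE zm) /= => /eqP; exact: IHm.
Qed.

(** [ad c] intertwines [ad d - z] with [ad d - (z + m)]. *)
Lemma gen_eigen_br Q Q' m c w : lie_br d c = m%:~R *: c ->
  (forall z, Q z -> Q' (z + m)) -> gen_eigen Q w -> gen_eigen Q' (lie_br c w).
Proof.
move=> dc QQ' [zs [hz wz]]; exists [seq z + m | z <- zs]; split.
  by rewrite all_map; apply: sub_all hz.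
rewrite -[RHS](lie_br0 c) -wz {hz wz}; elim: zs => //= z zs ->.
rewrite /eigen_step lie_ad dc lie_brZL lie_brD lie_brN lie_brZ intrD scalerDl.
by rewrite opprD !addrA [LHS](ACl (2*3*(1*4)))/= subrr addr0.
Qed.

End Eigen.

(** * The grading by the coefficients of the simple roots in [J] *)

Section Positive.
Variables (l : nat) (L : lieAlgebra CC) (e : 'I_l -> L) (J : pred 'I_l).

(** The degree-one part of the positive side, where only the indices in [J] count: the least
    subspace containing [e i] for [i] in [J] and stable under [ad (e j)] for the other [j]. *)
Inductive pos1 : L -> Prop :=
| pos1_0 : pos1 0
| pos1_lin a u v : pos1 u -> pos1 v -> pos1 (a *: u + v)
| pos1_e i : J i -> pos1 (e i)
| pos1_br j u : ~~ J j -> pos1 u -> pos1 (lie_br (e j) u).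

(* [posn n] is the component of degree [n + 1]. *)
Inductive posn : nat -> L -> Prop :=
| posn_1 u : pos1 u -> posn 0 u
| posn_0 n : posn n 0
| posn_lin n a u v : posn n u -> posn n v -> posn n (a *: u + v)
| posn_br n v u : pos1 v -> posn n u -> posn n.+1 (lie_br v u).

Lemma pos1Z a u : pos1 u -> pos1 (a *: u).
Proof. by move=> hu; rewrite -[_ *: u]addr0; apply: pos1_lin => //; exact: pos1_0. Qed.

Lemma pos1D u v : pos1 u -> pos1 v -> pos1 (u + v).
Proof. by move=> hu hv; rewrite -[u]scale1r; apply: pos1_lin. Qed.

Lemma pos1N u : pos1 u -> pos1 (- u).
Proof. by rewrite -scaleN1r; apply: pos1Z. Qed.

Lemma posnD n u v : posn n u -> posn n v -> posn n (u + v).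
Proof. by move=> hu hv; rewrite -[u]scale1r; apply: posn_lin. Qed.

End Positive.

Section Decomp.
Variables (l : nat) (A : 'M[RR]_l).
Variables (alpha : 'M[CC]_(hdim A, l)) (alphav : 'M[CC]_(l, hdim A)).
Variables (L : lieAlgebra CC).
Variable J : pred 'I_l.

Definition level0_gens (iota : 'rV[CC]_(hdim A) -> L) (e f : 'I_l -> L) (x : L) :=
  (exists u, x = iota u) \/ (exists j, ~~ J j /\ (x = e j \/ x = f j)).

Definition level0 iota e f := lie_gen (level0_gens iota e f).

Section OneSide.
Variables (iota : 'rV[CC]_(hdim A) -> L) (e f : 'I_l -> L).
Hypothesis rel : gkm_rel alpha alphav iota e f.
Notation G := (level0 iota e f).

Let Hlin : forall a u v, iota (a *: u + v) = a *: iota u + iota v.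
Proof. by case: rel. Qed.
Let Hef : forall i j, lie_br (e i) (f j) = if i == j then iota (row i alphav) else 0.
Proof. by case: rel => _ []. Qed.
Let Hhe : forall u i, lie_br (iota u) (e i) = (u *m alpha) 0 i *: e i.
Proof. by case: rel => _ [_ [_ []]]. Qed.
Let Hhf : forall u i, lie_br (iota u) (f i) = - ((u *m alpha) 0 i) *: f i.
Proof. by case: rel => _ [_ [_ [_ []]]]. Qed.
Let Hhh : forall u v, lie_br (iota u) (iota v) = 0.
Proof. by case: rel => _ [_ []]. Qed.
Let Hfe i j : lie_br (f i) (e j) = if i == j then - iota (row i alphav) else 0.
Proof. by rewrite lie_brC Hef eq_sym; case: eqP => [->|_]; rewrite ?oppr0. Qed.

Lemma iota0 : iota 0 = 0.
Proof. by have := Hlin (-1) 0 0; rewrite scaler0 addr0 scaleN1r addNr. Qed.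

Lemma iotaN u : iota (- u) = - iota u.
Proof. by have := Hlin (-1) u 0; rewrite iota0 !addr0 !scaleN1r. Qed.

Lemma level0_iota u : G (iota u).
Proof. by apply: lie_gen_sub; left; exists u. Qed.

Lemma pos1_h u x : pos1 e J x -> pos1 e J (lie_br (iota u) x).
Proof.
elim=> [|a y z _ IHy _ IHz|i Ji|j y Jj py IH].
- by rewrite lie_br0; exact: pos1_0.
- by rewrite lie_brDr; exact: pos1_lin.
- by rewrite Hhe; apply: pos1Z; exact: pos1_e.
- rewrite lie_ad Hhe lie_brZL; apply: pos1_lin; exact: pos1_br.
Qed.

Lemma pos1_f j x : ~~ J j -> pos1 e J x -> pos1 e J (lie_br (f j) x).
Proof.
move=> Jj; elim=> [|a y z _ IHy _ IHz|i Ji|k y Jk py IH].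
- by rewrite lie_br0; exact: pos1_0.
- by rewrite lie_brDr; exact: pos1_lin.
- rewrite Hfe; case: eqP => [ji|_]; last exact: pos1_0.
  by rewrite ji Ji in Jj.
- rewrite lie_ad Hfe; apply: pos1D; last exact: pos1_br.
  case: eqP => _; last by rewrite lie_0br; exact: pos1_0.
  by rewrite lie_brNL; apply: pos1N; exact: pos1_h.
Qed.

Lemma pos1_level0 g x : G g -> pos1 e J x -> pos1 e J (lie_br g x).
Proof.
move=> Gg; move: x; apply: (Gg (fun g => forall x, pos1 e J x -> pos1 e J (lie_br g x))).
- by move=> x _; rewrite lie_0br; exact: pos1_0.
- by move=> a u v hu hv x px; rewrite lie_brDl; apply: pos1_lin; auto.
- move=> u v hu hv x px; rewrite lie_adl; apply: pos1D; first by auto.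
  by apply: pos1N; auto.
- move=> _ [[u ->]|[j [Jj [->|->]]]] x px.
  + exact: pos1_h.
  + exact: pos1_br.
  + exact: pos1_f.
Qed.

Lemma posn_level0 n g x : G g -> posn e J n x -> posn e J n (lie_br g x).
Proof.
move=> Gg; elim=> [y py|m|m a y z _ IHy _ IHz|m y z py pz IH].
- by apply: posn_1; exact: pos1_level0.
- by rewrite lie_br0; exact: posn_0.
- by rewrite lie_brDr; exact: posn_lin.
- rewrite lie_ad; apply: posnD; apply: posn_br => //; exact: pos1_level0.
Qed.

(** [f i] commutes with every [e k] for [k] outside [J], and it sends [e i] to the negative of a
    coroot. *)
Lemma pos1_lower i x : J i -> pos1 e J x -> G (lie_br (f i) x).
Proof.
move=> Ji; elim=> [|a y z _ IHy _ IHz|k Jk|k y Jk py IH].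
- by rewrite lie_br0; exact: lie_gen0.
- by rewrite lie_brDr; exact: lie_gen_lin.
- rewrite Hfe; case: eqP => _; last exact: lie_gen0.
  by rewrite -iotaN; exact: level0_iota.
- rewrite lie_ad Hfe; case: eqP => [ik|_]; first by rewrite -ik Ji in Jk.
  rewrite lie_0br add0r; apply: lie_gen_br => //.
  by apply: lie_gen_sub; right; exists k; split=> //; left.
Qed.

Lemma posn_lower i n x : J i -> posn e J n x ->
  if n is m.+1 then posn e J m (lie_br (f i) x) else G (lie_br (f i) x).
Proof.
move=> Ji; elim=> [y py|m|m a y z _ IHy _ IHz|m y z py pz IH].
- exact: pos1_lower.
- by rewrite lie_br0; case: m => [|m]; [exact: lie_gen0 | exact: posn_0].
- by rewrite lie_brDr; case: m IHy IHz => [|m]; [exact: lie_gen_lin | exact: posn_lin].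
- rewrite lie_ad; apply: posnD; first by apply: posn_level0 => //; exact: pos1_lower.
  (* When [z] has degree one, its image under [f i] is in level zero, so the bracket with [y] is
     again of degree one. *)
  case: m IH pz => [|m] IH pz; last exact: posn_br.
  by rewrite lie_brC; apply: posn_1; apply: pos1N; exact: pos1_level0.
Qed.

Section Degree.
Variable u0 : 'rV[CC]_(hdim A).
Hypothesis u0J : forall j, (u0 *m alpha) 0 j = (J j)%:R.

(** [u0] is a grading element: its adjoint action multiplies by the degree. *)
Lemma level0_degree g : G g -> lie_br (iota u0) g = 0.
Proof.
move=> Gg; apply: (Gg (fun g => lie_br (iota u0) g = 0)) =>
  [||u v hu hv|_ [[u ->]|[j [Jj [->|->]]]]].
- by rewrite lie_br0.
- by move=> a u v hu hv; rewrite lie_brDr hu hv scaler0 addr0.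
- by rewrite lie_ad hu hv lie_0br lie_br0 addr0.
- by rewrite Hhh.
- by rewrite Hhe u0J (negbTE Jj) scale0r.
- by rewrite Hhf u0J (negbTE Jj) oppr0 scale0r.
Qed.

Lemma pos1_degree x : pos1 e J x -> lie_br (iota u0) x = x.
Proof.
elim=> [|a y z _ IHy _ IHz|i Ji|j y Jj py IH].
- by rewrite lie_br0.
- by rewrite lie_brDr IHy IHz.
- by rewrite Hhe u0J Ji scale1r.
- by rewrite lie_ad Hhe u0J (negbTE Jj) scale0r lie_0br add0r IH.
Qed.

Lemma posn_degree n x : posn e J n x -> lie_br (iota u0) x = n.+1%:R *: x.
Proof.
elim=> [y py|m|m a y z _ IHy _ IHz|m y z py pz IH].
- by rewrite scale1r pos1_degree.
- by rewrite lie_br0 scaler0.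
- by rewrite lie_brDr IHy IHz scalerDr !scalerA mulrC.
- rewrite lie_ad pos1_degree // IH lie_brZ.
  by rewrite -[m.+2%:R]natr1 scalerDl scale1r addrC.
Qed.

End Degree.

End OneSide.

Section TwoSides.
Variables (iota : 'rV[CC]_(hdim A) -> L) (e f : 'I_l -> L).
Hypothesis rel : gkm_rel alpha alphav iota e f.
Notation G := (level0 iota e f).

Lemma level0_opp x : level0 (fun u => - iota u) f e x <-> G x.
Proof.
split; apply: lie_gen_mono => y [[v ->]|[j [Jj hj]]]; [left|right|left|right].
- by exists (- v); rewrite (iotaN rel).
- by exists j; split=> //; case: hj; [right|left].
- by exists (- v); rewrite (iotaN rel) opprK.
- by exists j; split=> //; case: hj; [right|left].
Qed.

Inductive nonpos : L -> Prop :=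
| nonpos_G g : G g -> nonpos g
| nonpos_neg n x : posn f J n x -> nonpos x
| nonpos_lin a u v : nonpos u -> nonpos v -> nonpos (a *: u + v).

(* [x] has no component of degree greater than [m]. *)
Fixpoint top m x := if m is m'.+1 then exists2 c, posn e J m' c & top m' (x - c)
  else nonpos x.

Lemma top0 m : top m 0.
Proof.
elim: m => [|m IH] /=; first by apply: nonpos_G; exact: lie_gen0.
by exists 0; [exact: posn_0 | rewrite subr0].
Qed.

Lemma top_lin m a u v : top m u -> top m v -> top m (a *: u + v).
Proof.
elim: m u v => [|m IH] u v /=; first exact: nonpos_lin.
move=> [c pc hu] [c' pc' hv]; exists (a *: c + c'); first exact: posn_lin.
have -> : a *: u + v - (a *: c + c') = a *: (u - c) + (v - c').
  by rewrite scalerBr opprD addrACA.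
exact: IH.
Qed.

Lemma top_le m n x : (m <= n)%N -> top m x -> top n x.
Proof.
move=> /subnK <-; elim: (n - m)%N => //= k IH /IH hx.
by exists 0; [exact: posn_0 | rewrite subr0].
Qed.

Definition graded x := exists m, top m x.

Lemma graded_lin a u v : graded u -> graded v -> graded (a *: u + v).
Proof.
move=> [m hm] [n hn]; exists (maxn m n).
by apply: top_lin; [apply: top_le hm | apply: top_le hn]; rewrite ?leq_maxl ?leq_maxr.
Qed.

Lemma graded_pos n x : posn e J n x -> graded x.
Proof. by move=> px; exists n.+1 => /=; exists x => //; rewrite subrr; exact: top0. Qed.

Lemma graded_nonpos x : nonpos x -> graded x.
Proof. by exists 0. Qed.

Lemma graded_gens y x : (forall n u, posn e J n u -> graded (lie_br y u)) ->
  (forall g, G g -> graded (lie_br y g)) ->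
  (forall n u, posn f J n u -> graded (lie_br y u)) ->
  graded x -> graded (lie_br y x).
Proof.
move=> hp hG hn [m]; elim: m x => [|m IH] x /=.
  elim=> [g /hG //|n u /hn //|a u v _ hu _ hv].
  by rewrite lie_brDr; exact: graded_lin.
move=> [c pc /IH h]; rewrite -(subrK c x) lie_brD.
by rewrite -[lie_br y (x - c)]scale1r; apply: graded_lin => //; exact: hp pc.
Qed.

(** The sum of all components contains the generators and is stable under their adjoint actions.
    Directness is not claimed here; it is replaced later by the eigenvalues of a grading element. *)
Lemma graded_all : (forall x, lie_gen (gkm_gens iota e f) x) -> forall x, graded x.
Proof.
move=> gen.
have rel' := gkm_rel_opp rel.
have gradedN u : graded u -> graded (- u).
  move=> hu; rewrite -scaleN1r -[_ *: u]addr0; apply: graded_lin => //.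
  by exists 0%N; exact: (top0 0).
have gG y x : G y -> graded x -> graded (lie_br y x).
  move=> Gy; apply: graded_gens => [n u pu|g Gg|n u pu].
  - by apply: graded_pos; exact: posn_level0 rel _ _ _ Gy pu.
  - by apply/graded_nonpos/nonpos_G; exact: lie_gen_br.
  - apply/graded_nonpos/nonpos_neg; apply: (posn_level0 rel' _ pu).
    exact/level0_opp.
have stable y : gkm_gens iota e f y -> forall x, graded x -> graded (lie_br y x).
  move=> [[u ->]|[i hi]] x; first by apply: gG; exact: level0_iota.
  have [Ji|Ji] := boolP (J i); last first.
    by apply: gG; apply: lie_gen_sub; right; exists i.
  case: hi => ->; apply: graded_gens => [n u pu|g Gg|n u pu].
  - by apply: graded_pos; apply: (posn_br _ pu); exact: pos1_e.
  - rewrite lie_brC; apply: gradedN; apply: (graded_pos (n := 0)).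
    by apply: posn_level0 rel _ _ _ Gg _; apply: posn_1; exact: pos1_e.
  - apply: graded_nonpos; have := posn_lower rel' Ji pu.
    by case: n {pu} => [/level0_opp|n]; [exact: nonpos_G | exact: nonpos_neg].
  - have := posn_lower rel Ji pu.
    by case: n {pu} => [/nonpos_G/graded_nonpos|n /graded_pos].
  - rewrite lie_brC; apply: gradedN; apply/graded_nonpos/(nonpos_neg (n := 0)).
    apply: (posn_level0 rel'); first exact/level0_opp.
    by apply: posn_1; exact: pos1_e.
  - by apply/graded_nonpos/nonpos_neg; apply: (posn_br _ pu); exact: pos1_e.
have ad y x : graded x -> graded (lie_br y x).
  apply: (gen y (fun y => forall x, graded x -> graded (lie_br y x))) => {x y}.
  - by move=> x hx; rewrite lie_0br; exists 0%N; exact: (top0 0).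
  - by move=> a u v hu hv x hx; rewrite lie_brDl; apply: graded_lin; auto.
  - move=> u v hu hv x hx; rewrite lie_adl -[lie_br u _]scale1r.
    by apply: graded_lin; [|apply: gradedN]; auto.
  - exact: stable.
move=> x; apply: (gen x graded).
- by exists 0%N; exact: (top0 0).
- exact: graded_lin.
- by move=> u v _; exact: ad.
- move=> y [[u ->]|[i hi]].
    by apply/graded_nonpos/nonpos_G; exact: level0_iota.
  have [Ji|Ji] := boolP (J i); last first.
    by apply/graded_nonpos/nonpos_G; apply: lie_gen_sub; right; exists i.
  case: hi => ->; first by apply: (graded_pos (n := 0)); apply: posn_1; exact: pos1_e.
  by apply/graded_nonpos/(nonpos_neg (n := 0)); apply: posn_1; exact: pos1_e.
Qed.

End TwoSides.

End Decomp.

(** * Elements of positive degree *)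

Section Forms.
Variables (K : fieldType) (L : lieAlgebra K).
Implicit Types (phi psi : mform L) (s t : seq L) (lam : L -> K).
Local Notation ev := mform_eval.

Lemma shift_multi s phi : @multilin K L (fun t => ev phi (t ++ s)).
Proof. by move=> s1 s2 c u v; rewrite -!catA !cat_cons; exact: mformP. Qed.

(** The transpose of right multiplication by the word [s], which commutes with all left
    multiplications. *)
Definition shift s phi : mform L := mk_form (shift_multi s phi).

Fixpoint right_normed s : L :=
  if s is v :: s' then (if s' is [::] then v else lie_br v (right_normed s')) else 0.

Lemma right_normed_cons v s : s != [::] ->
  right_normed (v :: s) = lie_br v (right_normed s).
Proof. by case: s. Qed.

Lemma right_normed_multi lam : is_functional (U := L) lam ->
  @multilin K L (fun s => lam (right_normed s)).
Proof.
move=> h s t c u v; rewrite -h; congr lam; elim: s => [|w s IH].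
  by case: t => //= w t; rewrite lie_brDl.
have nz x : s ++ x :: t != [::] by case: (s).
by rewrite !cat_cons !right_normed_cons // IH lie_brDr.
Qed.

Definition lam_rn lam (h : is_functional lam) : mform L :=
  mk_form (right_normed_multi h).

(** The product of [f] on the first [n] letters and [g] on the rest, with value 0 on words shorter
    than [n]. *)
Fixpoint tens_fun n (f g : seq L -> K^o) s : K^o :=
  match n, s with
  | 0, _ => f [::] * g s
  | n'.+1, v :: s' => tens_fun n' (mcons v f) g s'
  | _.+1, [::] => 0
  end.

Lemma tens_lin n c f1 f2 g s :
  tens_fun n (c *: f1 + f2) g s = c * tens_fun n f1 g s + tens_fun n f2 g s.
Proof.
elim: n f1 f2 s => [|n IH] f1 f2 s /=; first by rewrite mulrDl -mulrA.
case: s => [|v s]; first by rewrite mulr0 addr0.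
by rewrite -IH.
Qed.

Lemma tens_multi n phi psi : @multilin K L (tens_fun n (ev phi) (ev psi)).
Proof.
move: (ev phi) (mformP phi) => f hf; have hg := mformP psi; move: (ev psi) hg => g hg.
elim: n f hf => [|n IH] f hf s t c u v /=.
  by rewrite hg mulrDr mulrCA.
case: s => [|w s] /=; first by rewrite mcons_lin // tens_lin.
by apply: IH; exact: multilin_mcons.
Qed.

Definition tens n phi psi : mform L := mk_form (tens_multi n phi psi).

Lemma tens_cat n (f g : seq L -> K^o) t s : size t = n ->
  tens_fun n f g (t ++ s) = f t * g s.
Proof. by move=> <-; elim: t f => //= v t IH f; rewrite IH. Qed.

Lemma lin1_multi lam : is_functional (U := L) lam ->
  @multilin K L (fun s => if s is [:: v] then lam v else 0).
Proof.
move=> h [|w s] t c u v /=; first by case: t => [|? ?]; [exact: h | rewrite mulr0 addr0].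
by case: s => [|? ?] /=; rewrite mulr0 addr0.
Qed.

Definition lin1 lam (h : is_functional lam) : mform L := mk_form (lin1_multi h).

Lemma unit_multi : @multilin K L (fun s => if s is [::] then 1 else 0).
Proof. by move=> [|w s] t c u v /=; rewrite mulr0 addr0. Qed.

Definition unit_form : mform L := mk_form unit_multi.

Lemma tens1E lam (h : is_functional lam) psi v s :
  ev (tens 1 (lin1 h) psi) (v :: s) = lam v * ev psi s.
Proof. by []. Qed.

Lemma tens0E n g s : tens_fun n (fun=> 0) g s = 0.
Proof. by elim: n s => [|n IH] [|v s] //=; rewrite ?mul0r. Qed.

End Forms.

Section NonNilpotent.
Variables (l : nat) (L : lieAlgebra CC) (e : 'I_l -> L) (i : 'I_l).
Variable act : L -> mform L -> mform L.
Implicit Types (phi psi : mform L) (s t : seq L).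
Local Notation ev := mform_eval.
Hypothesis act_lin : forall c x y phi s,
  ev (act (c *: x + y) phi) s = c * ev (act x phi) s + ev (act y phi) s.
Hypothesis act_form_lin : forall x c phi psi,
  act x (c *: phi + psi) = c *: act x phi + act x psi.
Hypothesis act_br : forall x y phi s,
  ev (act (lie_br x y) phi) s = ev (act y (act x phi)) s - ev (act x (act y phi)) s.
Hypothesis act_e : forall phi s, ev (act (e i) phi) s = ev phi (e i :: s).
Hypothesis act_der : forall j phi s,
  j != i -> ev (act (e j) phi) s = der (e j) (ev phi) s.
Local Notation V := (pos1 e (pred1 i)).
Local Notation N := (posn e (pred1 i)).

Lemma act0 phi : act 0 phi = 0.
Proof.
apply: mform_inj => s; have := act_lin (-1) 0 0 phi s.
by rewrite scaler0 addr0 mulN1r addNr.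
Qed.

Lemma act_form0 x : act x 0 = 0.
Proof. by have := act_form_lin x (-1) 0 0; rewrite scaler0 addr0 scaleN1r addNr. Qed.

Lemma act_formZ x c phi : act x (c *: phi) = c *: act x phi.
Proof. by have := act_form_lin x c phi 0; rewrite act_form0 !addr0. Qed.

Lemma iter_act_formZ k x c phi : iter k (act x) (c *: phi) = c *: iter k (act x) phi.
Proof. by elim: k => //= k ->; rewrite act_formZ. Qed.

Lemma iter_act_form0 k x : iter k (act x) 0 = 0.
Proof. by elim: k => //= k ->; rewrite act_form0. Qed.

(** The commutator of the derivation [ad (e j)] with left multiplication by [u] is left
    multiplication by [[e j, u]], so the rule for [e i] spreads to all of [V]. *)
Lemma act_pos1 v phi s : V v -> ev (act v phi) s = ev phi (v :: s).
Proof.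
move=> hv; elim: hv phi s => [|c u w _ IHu _ IHw|j /eqP -> //|j u ji hu IH] phi s.
- by rewrite act0 mform0 multilin0 //; exact: mformP.
- by rewrite act_lin IHu IHw multilin_head //; exact: mformP.
- rewrite act_br IH !act_der //=.
  have -> : ev (act u phi) = mcons u (ev phi) by apply: funext => t; rewrite IH.
  by rewrite addrK.
Qed.

(** [y] acts by left multiplication by a tensor, which commutes with right multiplication by [s].
    Hence the values at the empty word determine the action. *)
Lemma act_shift n y phi s : N n y ->
  ev (act y phi) s = ev (act y (shift s phi)) [::].
Proof.
move=> hy; elim: hy phi s => {n y}
  [y hy|n|n c y z _ IHy _ IHz|n v y hv hy IH] phi s.
- by rewrite !act_pos1.
- by rewrite !act0 !mform0.
- by rewrite !act_lin -IHy -IHz.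
- rewrite !act_br !(act_pos1 _ _ hv) (IH _ s) (IH phi) (IH (shift s phi)).
  have -> : shift s (act v phi) = act v (shift s phi).
    by apply: mform_inj => t; rewrite act_pos1 // [LHS]act_pos1.
  have -> // : shift [:: v] (shift s phi) = shift (v :: s) phi.
  by apply: mform_inj => t; rewrite /= /mform_eval /= -catA.
Qed.

(** The tensor of [y] is homogeneous of degree [n.+1], and the value at the empty word is its
    pairing with the form. *)
Lemma act_ext n y phi psi : N n y ->
  (forall t, size t = n.+1 -> ev phi t = ev psi t) ->
  ev (act y phi) [::] = ev (act y psi) [::].
Proof.
move=> hy; elim: hy phi psi => {n y}
  [y hy|n|n c y z _ IHy _ IHz|n v y hv hy IH] phi psi E.
- by rewrite !act_pos1 // E.
- by rewrite !act0.
- by rewrite !act_lin (IHy _ _ E) (IHz _ _ E).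
- rewrite !act_br !(act_pos1 _ _ hv); congr (_ - _).
    by apply: IH => t ht; rewrite !act_pos1 // E //= ht.
  rewrite (act_shift _ _ hy) [RHS](act_shift _ _ hy); apply: IH => t ht.
  by apply: E; rewrite size_cat ht addn1.
Qed.

Lemma act_ext_cons n y phi psi s : N n y ->
  (forall t, t != [::] -> ev phi t = ev psi t) ->
  ev (act y phi) s = ev (act y psi) s.
Proof.
move=> hy E; rewrite (act_shift _ _ hy) [RHS](act_shift _ _ hy).
by apply: act_ext hy _ => -[|v t] // _; apply: E.
Qed.

Lemma functional_ad (lam : L -> CC) v : is_functional lam ->
  is_functional (fun x => lam (lie_br v x)).
Proof. by move=> h a x y; rewrite lie_brDr h. Qed.

Lemma act_lam_cons v (lam : L -> CC) (h : is_functional lam) t : V v -> t != [::] ->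
  ev (act v (lam_rn h)) t = ev (lam_rn (functional_ad v h)) t.
Proof. by move=> hv; case: t => // w t _; rewrite act_pos1. Qed.

(** The right-normed bracket carries left multiplication by [y] to [ad y]. The empty word is
    excluded because the bracket of a single letter is the letter itself. *)
Lemma act_right_normed n y (lam : L -> CC) (h : is_functional lam) s :
  N n y -> s != [::] ->
  ev (act y (lam_rn h)) s = lam (lie_br y (right_normed s)).
Proof.
move=> hy; elim: hy lam h s => {n y}
  [y hy|n|n c y z _ IHy _ IHz|n v y hv hy IH] lam h s ns.
- by rewrite act_lam_cons.
- rewrite act0 lie_0br mform0; have := h (-1) 0 0.
  by rewrite scaler0 addr0 mulN1r addNr.
- by rewrite act_lin IHy // IHz // lie_brDl h.
- rewrite act_br (act_pos1 _ _ hv).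
  rewrite (@act_ext_cons _ _ _ (lam_rn (functional_ad v h)) _ hy); last first.
    by move=> t nt; rewrite act_lam_cons.
  rewrite !IH // right_normed_cons // lie_adl [X in _ = lam X]addrC.
  by rewrite -scaleN1r h mulN1r [RHS]addrC.
Qed.

(* The Dynkin-Specht-Wever identity; it makes the action of [posn n] faithful. *)
Lemma act_right_normed0 n y (lam : L -> CC) (h : is_functional lam) :
  N n y -> ev (act y (lam_rn h)) [::] = n.+1%:R * lam y.
Proof.
move=> hy; elim: hy lam h => {n y}
  [y hy|n|n c y z _ IHy _ IHz|n v y hv hy IH] lam h.
- by rewrite act_pos1 // mul1r.
- rewrite act0 mform0; have := h (-1) 0 0.
  by rewrite scaler0 addr0 mulN1r addNr => ->; rewrite mulr0.
- by rewrite act_lin IHy IHz h; ring.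
- rewrite act_br (act_pos1 _ _ hv).
  rewrite (@act_ext_cons _ _ _ (lam_rn (functional_ad v h)) _ hy); last first.
    by move=> t nt; rewrite act_lam_cons.
  (* The induction hypothesis gives [n.+1] copies of [lam [v, y]], and the term [- lam [y, v]] gives
     one more. *)
  rewrite IH (act_right_normed _ hy) //= (lie_brC y).
  have -> u : lam (- u) = - lam u.
    have h0 : lam 0 = 0 by have := h (-1) 0 0; rewrite scaler0 addr0 mulN1r addNr.
    by have := h (-1) u 0; rewrite h0 !addr0 scaleN1r mulN1r.
  by rewrite opprK -[n.+2%:R]natr1 mulrDl mul1r.
Qed.

Lemma act_faithful n x : N n x -> x != 0 -> exists phi, ev (act x phi) [::] != 0.
Proof.
move=> hx x0.
have [a|lam [h lx _]] := @functional_sep _ _ x 0.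
  by rewrite scaler0; exact/eqP.
by exists (lam_rn h); rewrite (act_right_normed0 _ hx) lx mulr1 pnatr_eq0.
Qed.

Lemma act_tens n x phi psi : N n x ->
  act x (tens n.+1 phi psi) = ev (act x phi) [::] *: psi.
Proof.
move=> hx; apply: mform_inj => s; rewrite (act_shift _ _ hx).
rewrite (@act_ext _ _ _ (ev psi s *: phi) hx).
  by rewrite act_formZ; exact: mulrC.
by move=> t ht; rewrite [LHS](tens_cat _ _ _ ht); exact: mulrC.
Qed.

(** Each [act x] strips [n.+1] letters off an iterated product of copies of [phi]. If [phi] pairs
    nontrivially with [x], then no power of [x] acts as zero. *)
Lemma act_power n x phi k : N n x ->
  exists psi, iter k (act x) psi = ev (act x phi) [::] ^+ k *: unit_form L.
Proof.
move=> hx; elim: k => [|k [psi IH]]; first by exists (unit_form L); rewrite scale1r.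
exists (tens n.+1 phi psi).
by rewrite iterSr act_tens // iter_act_formZ IH scalerA -exprS.
Qed.

Definition homog (w : mform L -> mform L) := forall c psi, w (c *: psi) = c *: w psi.

(** In the tensor algebra, [(ad x)^k y] is [(-1)^k y x^k] plus terms that begin with [x]. For a
    right action the latter apply [act x] first, whence the shape [w (act x phi)]. *)
Lemma act_iter_br x y k : exists2 w, homog w & forall phi,
  act (iter k (lie_br x) y) phi =
    w (act x phi) + (-1) ^+ k *: iter k (act x) (act y phi).
Proof.
elim: k => [|k [w hw IH]].
  by exists (fun=> 0) => [c psi|phi]; rewrite ?scaler0 //= scale1r add0r.
exists (fun psi => act (iter k (lie_br x) y) psi - act x (w psi)).
  by move=> c psi; rewrite act_formZ hw act_formZ scalerBr.
move=> phi; rewrite iterS.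
have -> : act (lie_br x (iter k (lie_br x) y)) phi =
    act (iter k (lie_br x) y) (act x phi) - act x (act (iter k (lie_br x) y) phi).
  by apply: mform_inj => s; rewrite act_br mformB.
rewrite (IH phi) -[w _]scale1r act_form_lin !act_formZ scale1r opprD addrA.
by rewrite exprS mulN1r scaleNr.
Qed.

Lemma act_nil x y k : iter k (lie_br x) y = 0 ->
  exists2 w, homog w & forall phi, iter k (act x) (act y phi) = w (act x phi).
Proof.
move=> xy; have [w hw E] := act_iter_br x y k.
exists (fun psi => - (-1) ^+ k *: w psi).
  by move=> c psi; rewrite hw !scalerA mulrC.
move=> phi; have := E phi; rewrite xy act0 => /esym/eqP.
rewrite addr_eq0 => /eqP ->.
by rewrite scalerN scaleNr opprK scalerA -expr2 sqrr_sign scale1r.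
Qed.

(* In the tensor algebra, [(ad x)^k y = 0] puts [y x^k] in the right ideal
   generated by [x]; this cannot happen for two independent vectors [y]. *)
Lemma posn_not_nilpotent n x y1 y2 k1 k2 (del eps : L -> CC) :
  N n x -> V y1 -> V y2 ->
  is_functional del -> del y1 = 0 -> del y2 = 1 ->
  is_functional eps -> eps y1 = 1 ->
  iter k1 (lie_br x) y1 = 0 -> iter k2 (lie_br x) y2 = 0 -> x = 0.
Proof.
move=> hx h1 h2 hd d1 d2 he e1 /act_nil [w1 hw1 E1] /act_nil [w2 hw2 E2].
apply/eqP; apply: contraT => x0.
have [phi0 T0] := act_faithful hx x0.
have actV y lam (h : is_functional lam) psi : V y ->
    act y (tens 1 (lin1 h) psi) = lam y *: psi.
  by move=> hy; apply: mform_inj => s; rewrite (act_pos1 _ _ hy) tens1E mformZ.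
have [psi1 P1] := act_power phi0 k1 hx.
have [psi2 P2] := act_power phi0 k2 hx.
(* By the relation for [y1], [w1 chi] is the nonzero multiple of [unit_form] given by [P1]. *)
pose chi := act x (tens 1 (lin1 he) psi1).
have w1chi : ev (w1 chi) [::] != 0.
  rewrite -E1 actV // e1 scale1r P1.
  by rewrite mformZ mulf_neq0 ?oner_neq0 ?expf_neq0.
(* A form starting with [del] is killed by [y1]. Appending [chi] to it turns the relation for [y1]
   into a scalar times [w1 chi] being zero, and that scalar is the value in question. *)
have dx0 psi : ev (act x (tens 1 (lin1 hd) psi)) [::] = 0.
  have := E1 (tens n.+1 (tens 1 (lin1 hd) psi) chi).
  have -> : act y1 (tens n.+1 (tens 1 (lin1 hd) psi) chi) = 0.
    apply: mform_inj => s; rewrite act_pos1 // mform0.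
    rewrite -[RHS](@tens0E _ L n (ev chi) s) /mform_eval /=.
    congr (tens_fun n _ _ s); apply: funext => t.
    by rewrite /mcons /= d1 mul0r.
  rewrite iter_act_form0 act_tens // hw1 => /esym E.
  have /eqP : ev (ev (act x (tens 1 (lin1 hd) psi)) [::] *: w1 chi) [::] = 0.
    by rewrite E.
  by rewrite mformZ mulf_eq0 (negbTE w1chi) orbF => /eqP.
have dx psi : act x (tens 1 (lin1 hd) psi) = 0.
  apply: mform_inj => s; rewrite (act_shift _ _ hx) mform0 -(dx0 (shift s psi)).
  by apply: act_ext hx _ => -[|v t].
(* As [del y2 = 1], the left side of the relation for [y2] is a nonzero multiple of [unit_form],
   while the right side is [w2 0 = 0]. *)
have := E2 (tens 1 (lin1 hd) psi2).
rewrite actV // d2 scale1r P2 dx -[X in w2 X](scale0r (0 : mform L)) hw2 scale0r.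
move=> /(congr1 (fun phi => ev phi [::])) /eqP.
by rewrite mform0 mformZ mulf_eq0 oner_eq0 orbF expf_eq0 (negbTE T0) andbF.
Qed.

End NonNilpotent.

(** * Locally nilpotent elements *)

Section TopComponent.
Variables (l : nat) (A : 'M[RR]_l).
Variables (alpha : 'M[CC]_(hdim A, l)) (alphav : 'M[CC]_(l, hdim A)).
Variables (L : lieAlgebra CC) (J : pred 'I_l).
Variables (iota : 'rV[CC]_(hdim A) -> L) (e f : 'I_l -> L).
Hypothesis rel : gkm_rel alpha alphav iota e f.
Variable u0 : 'rV[CC]_(hdim A).
Hypothesis u0J : forall j, (u0 *m alpha) 0 j = (J j)%:R.
Local Notation d := (iota u0).

Lemma negn_degree n x : posn f J n x -> lie_br d x = (- n.+1%:Z)%:~R *: x.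
Proof.
move=> /(posn_degree (gkm_rel_opp rel) u0J).
by rewrite lie_brNL => /eqP; rewrite eqr_oppLR -scaleNr mulrNz => /eqP.
Qed.

Lemma posn_degreez n x : posn e J n x -> lie_br d x = (n.+1%:Z)%:~R *: x.
Proof. exact: (posn_degree rel u0J). Qed.

Lemma top_shift m r (z : int) w : top J iota e f m r ->
  gen_eigen d (fun t => t < z) w ->
  gen_eigen d (fun t => t < z + m%:Z) (lie_br r w).
Proof.
elim: m r => [|m IH] r /= + hw.
  elim=> [g hg|n x hx|a u v _ hu _ hv].
  - apply: (gen_eigen_br (m := 0)) hw => [|t]; last by lia.
    by rewrite (level0_degree rel u0J hg) scale0r.
  - by apply: gen_eigen_br (negn_degree hx) _ hw => t; lia.
  - by rewrite lie_brDl; exact: gen_eigen_lin.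
move=> [c hc hr]; rewrite -(subrK c r) lie_brDL; apply: gen_eigen_add.
  by apply: gen_eigen_mono (IH _ hr hw) => t; lia.
by apply: gen_eigen_br (posn_degreez hc) _ hw => t; lia.
Qed.

(** [(ad c)^n y] is the leading term of [(ad x)^n y]: its degree is [1 + n * m.+1], and the
    difference has only smaller eigenvalues. Once [(ad x)^k y] vanishes, [gen_eigen_disj] kills the
    leading term. *)
Lemma top_component_nil m x c y : posn e J m c -> top J iota e f m (x - c) ->
  ad_locnil x -> lie_br d y = y -> exists k, iter k (lie_br c) y = 0.
Proof.
move=> hc hr /(_ y) [k xy] dy; exists k.
pose z n : int := 1 + n%:Z * m.+1%:Z.
have dc n : lie_br d (iter n (lie_br c) y) = (z n)%:~R *: iter n (lie_br c) y.
  elim: n => [|n IH] /=; first by rewrite /z mul0r addr0 scale1r.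
  rewrite lie_ad (posn_degreez hc) IH lie_brZL lie_brZ -scalerDl -intrD.
  by congr (_%:~R *: _); rewrite /z; lia.
have H n : gen_eigen d (fun t => t < z n)
    (iter n (lie_br x) y - iter n (lie_br c) y).
  elim: n => [|n IH] /=.
    by rewrite subrr; exists [::].
  set u := iter n _ y in IH *; set v := iter n _ y in IH *.
  have hu : gen_eigen d (fun t => t < z n + 1) u.
    rewrite -(subrK v u); apply: gen_eigen_add.
      by apply: gen_eigen_mono IH => t; lia.
    by apply: (gen_eigen_hom (dc n)); lia.
  have -> : lie_br x u - lie_br c v = lie_br (x - c) u + lie_br c (u - v).
    by rewrite lie_brD lie_brN lie_brDL lie_brNL addrA subrK.
  apply: gen_eigen_add.
    by apply: gen_eigen_mono (top_shift hr hu) => t; rewrite /z; lia.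
  by apply: gen_eigen_br (posn_degreez hc) _ IH => t; rewrite /z; lia.
have := H k; rewrite xy sub0r => h.
apply: (gen_eigen_disj (d := d) (Q := pred1 (z k)) (Q' := fun t => t < z k)).
- by move=> t /eqP ->; rewrite ltxx.
- by apply: (gen_eigen_hom (dc k)); exact: eqxx.
- have : gen_eigen d (fun t => t < z k) 0 by exists [::].
  by move=> /(gen_eigen_lin (-1) h); rewrite scaleN1r opprK addr0.
Qed.

Lemma nonpos_split x : nonpos J iota e f x ->
  exists g r, [/\ level0 J iota e f g, gen_eigen d (fun t => t < 0) r & x = g + r].
Proof.
elim=> [g hg|n y hy|a u v _ [g [r [hg hr ->]]] _ [g' [r' [hg' hr' ->]]]].
- by exists g, 0; split; rewrite ?addr0 //; exists [::].
- exists 0, y; split; [exact: lie_gen0 | | by rewrite add0r].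
  by apply: (gen_eigen_hom (negn_degree hy)); lia.
- exists (a *: g + g'), (a *: r + r'); split; first exact: lie_gen_lin.
    exact: gen_eigen_lin.
  by rewrite scalerDr addrACA.
Qed.

Lemma top_split m x : top J iota e f m x ->
  exists g r, [/\ level0 J iota e f g, gen_eigen d (fun t => t != 0) r & x = g + r].
Proof.
elim: m x => [|m IH] x /=.
  move=> /nonpos_split [g [r [hg hr ->]]]; exists g, r; split=> //.
  by apply: gen_eigen_mono hr => t; lia.
move=> [c hc /IH [g [r [hg hr E]]]]; exists g, (r + c); split=> //.
  by apply: gen_eigen_add => //; apply: (gen_eigen_hom (posn_degreez hc)); lia.
by rewrite addrA -E subrK.
Qed.

End TopComponent.

Lemma gen_eigen_opp (L : lieAlgebra CC) (d : L) (Q Q' : pred int) w :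
  (forall z, Q z -> Q' (- z)) -> gen_eigen (- d) Q w -> gen_eigen d Q' w.
Proof.
move=> QQ' [zs [hz wz]]; exists [seq - z | z <- zs]; split.
  by rewrite all_map; apply: sub_all hz.
(* Each factor changes sign, so the two products agree up to the parity of the length. *)
suff: eigen_kill d [seq - z | z <- zs] w = eigen_kill (- d) zs w \/
      eigen_kill d [seq - z | z <- zs] w = - eigen_kill (- d) zs w.
  by rewrite wz oppr0 => -[].
elim: zs {hz wz} => [|z zs [] /= ->]; first by left.
- by right; rewrite /eigen_step lie_brNL mulrNz scaleNr opprD !opprK.
- by left; rewrite /eigen_step lie_brN lie_brNL mulrNz scaleNr scalerN opprK.
Qed.

(** * Vanishing of the imaginary degrees and the two inclusions *)

Section Main.
Variables (l : nat) (A : 'M[RR]_l).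
Hypotheses (hA : BKM_matrix A) (hind : indecomposable A) (hl : (2 <= l)%N).
Variables (alpha : 'M[CC]_(hdim A, l)) (alphav : 'M[CC]_(l, hdim A)).
Hypothesis hreal : is_realization alpha alphav.
Variable L : lieAlgebra CC.

Lemma adjacent_ex i : exists2 j, j != i & A j i != 0.
Proof.
have [k ki] : exists k : 'I_l, k != i.
  have [E|E] := eqVneq (val i) 0%N.
    by exists (Ordinal hl); rewrite -val_eqE /= E.
  by exists (Ordinal (ltnW hl)); rewrite -val_eqE /= eq_sym.
(* The neighbour is the first vertex on a path from [i] to some other vertex. *)
have /connectP [[|j p] /= hp E] := hind i k.
  by rewrite E eqxx in ki.
move: hp => /andP[/andP[ij Aij] _]; exists j; first by rewrite eq_sym.
by apply: contra_neq Aij => h; apply/(hA.2.2.2 i j).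
Qed.

(** The simple roots are linearly independent, so they take arbitrary prescribed values on some
    vector of the Cartan subalgebra. *)
Lemma degree_vector (J : pred 'I_l) : exists u : 'rV[CC]_(hdim A),
  forall j, (u *m alpha) 0 j = (J j)%:R.
Proof.
have [_ [ha _]] := hreal.
have : row_full alpha by rewrite /row_full -mxrank_tr.
move=> /row_fullP [B BA]; exists ((\row_j (J j)%:R) *m B) => j.
by rewrite -mulmxA BA mulmx1 mxE.
Qed.

Lemma nonpos_of_locnil iota (e f : 'I_l -> L) i x :
  is_GKM alpha alphav iota e f -> A i i != 2 -> ad_locnil x ->
  nonpos (pred1 i) iota e f x.
Proof.
move=> hg Aii nilx.
have [rel _] := hg; have [Hlin [Hef [Hhh [Hhe [Hhf _]]]]] := rel.
have [u0 u0J] := degree_vector (pred1 i).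
have [m hm] := graded_all (pred1 i) rel (gkm_generated hg) x.
elim: m hm => [//|m IH] /= [c hc hr].
suff c0 : c = 0 by apply: IH; rewrite -[x]subr0 -c0.
have [j ji Aji] := adjacent_ex i.
have V1 : pos1 e (pred1 i) (e i) by apply: pos1_e; exact: eqxx.
have V2 : pos1 e (pred1 i) (lie_br (e j) (e i)) by exact: pos1_br.
have nil y : pos1 e (pred1 i) y -> exists k, iter k (lie_br c) y = 0.
  move=> hy; apply: (top_component_nil rel u0J hc hr nilx).
  exact: (pos1_degree rel u0J hy).
have [k1 n1] := nil _ V1; have [k2 n2] := nil _ V2.
apply/eqP; apply: contraT => c0.
(* If [e i] were zero, the whole positive part would vanish, and [c] with it. *)
have e0 : e i <> 0.
  move=> e0; move/eqP: c0; apply.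
  have p0 y : pos1 e (pred1 i) y -> y = 0.
    elim=> [//|a u v _ -> _ ->|k /eqP -> //|k u _ _ ->].
      by rewrite scaler0 addr0.
    by rewrite lie_br0.
  elim: {hr n1 n2 nil} hc => [y /p0 //|//|n a y z _ -> _ ->|n y z /p0 -> _ _].
    by rewrite scaler0 addr0.
  by rewrite lie_0br.
(* [ad (f j)] kills [e i] but sends [[e j, e i]] to [- A j i] times [e i], which is nonzero. *)
have ne2 a : lie_br (e j) (e i) <> a *: e i.
  move=> /(congr1 (lie_br (f j))).
  rewrite lie_ad lie_brZ !(lie_brC (f j)) !Hef eqxx eq_sym (negbTE ji).
  rewrite oppr0 lie_br0 addr0 scaler0 lie_brNL Hhe.
  have [_ [_ aE]] := hreal.
  rewrite -row_mul aE !mxE => /eqP; rewrite oppr_eq0 scaler_eq0 => /orP[]/eqP //.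
  by move=> [] /eqP; apply/negP.
have [del [hd d2 d1]] := functional_sep ne2.
have [a|eps [he e1 _]] := @functional_sep _ _ (e i) 0; first by rewrite scaler0.
have [act [a1 a2 a3 [a4 a5]]] := form_action hg Aii.
by rewrite (posn_not_nilpotent a1 a2 a3 a4 a5 hc V1 V2 hd d1 d2 he e1 n1 n2) eqxx in c0.
Qed.

(** The previous lemma for both choices of sign writes [x] as degree zero plus negative and as
    degree zero plus positive. Comparing eigenvalues removes both remainders. *)
Lemma degree_zero iota (e f : 'I_l -> L) i x (u0 : 'rV[CC]_(hdim A)) :
  is_GKM alpha alphav iota e f -> A i i != 2 -> ad_locnil x ->
  (forall j, (u0 *m alpha) 0 j = (pred1 i j)%:R) -> lie_br (iota u0) x = 0.
Proof.
move=> hg Aii nilx u0J.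
have [rel _] := hg; have rel' := gkm_rel_opp rel.
have [g [r [hg1 hr E]]] := nonpos_split rel u0J (nonpos_of_locnil hg Aii nilx).
have [g' [r' [hg1' hr' E']]] :=
  nonpos_split rel' u0J (nonpos_of_locnil (is_GKM_opp hg) Aii nilx).
have {}hr' : gen_eigen (iota u0) (fun t => 0 < t) r'.
  by apply: gen_eigen_opp hr' => t; lia.
have dg := level0_degree rel u0J hg1.
have dg' : lie_br (iota u0) g' = 0.
  by apply: (level0_degree rel u0J); apply/(level0_opp _ rel).
suff rr' : r = r'.
  have r0 : r = 0.
    apply: gen_eigen_disj hr (_ : gen_eigen _ (fun t => 0 < t) r) => [t|].
      by lia.
    by rewrite rr'.
  by rewrite E r0 addr0.
apply/eqP; rewrite -subr_eq0; apply/eqP.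
apply: (gen_eigen_disj (d := iota u0) (Q := fun t => t != 0) (Q' := pred1 0)).
- by [].
- have h1 : gen_eigen (iota u0) (fun t => t != 0) r.
    by apply: gen_eigen_mono hr => t; lia.
  have h2 : gen_eigen (iota u0) (fun t => t != 0) r'.
    by apply: gen_eigen_mono hr' => t; lia.
  by rewrite addrC -scaleN1r; exact: gen_eigen_lin.
- apply: (gen_eigen_hom (z := 0)) => //.
  have -> : r - r' = g' - g.
    by apply/eqP; rewrite subr_eq addrAC eq_sym subr_eq -E' E addrC.
  by rewrite lie_brD lie_brN dg dg' subr0 scale0r.
Qed.

Lemma real_locnil iota (e f : 'I_l -> L) i :
  is_GKM alpha alphav iota e f -> A i i = 2 -> ad_locnil (e i).
Proof.
move=> hg Aii y.
have [[_ [Hef [_ [Hhe [_ [Hserre _]]]]]] _] := hg.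
have [_ [off [int_row _]]] := hA.
apply: (lie_gen_ad_nil _ (gkm_generated hg y)) => _ [[u ->]|[j [->|->]]].
- by exists 2%N; rewrite /= (lie_brC _ (iota u)) Hhe lie_brN lie_brZ lie_brxx scaler0 oppr0.
- have [<-|ij] := eqVneq i j; first by exists 1%N; rewrite /= lie_brxx.
  have [z zE] := int_row i j Aii.
  have z0 : z <= 0 by have := off i j ij; rewrite zE lerz0.
  (* The Serre exponent [1 - A i j], a natural number because [A i j] is a nonpositive integer. *)
  exists `|1 - z|%N; apply: (Hserre i j _ Aii ij _).1.
  by rewrite zE pmulrn gez0_abs ?intrB // subr_ge0 (le_trans z0).
(* Three steps: [f i] goes to a coroot, then to a multiple of [e i], then to 0. *)
- exists 3%N; rewrite /= Hef; case: eqP => _; last by rewrite !lie_br0.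
  by rewrite [lie_br (e i) (iota _)]lie_brC Hhe lie_brN lie_brZ lie_brxx scaler0 oppr0.
Qed.

Section Conclusion.
Variables (iota : 'rV[CC]_(hdim A) -> L) (e f : 'I_l -> L).
Hypothesis hg : is_GKM alpha alphav iota e f.

Definition gBh (x : L) :=
  exists (y : L) (u : 'rV[CC]_(hdim A)), gB A e f y /\ x = y + iota u.

Let rel : gkm_rel alpha alphav iota e f := hg.1.

Lemma gBh_lin a u v : gBh u -> gBh v -> gBh (a *: u + v).
Proof.
move=> [y [s [hy ->]]] [z [t [hz ->]]]; exists (a *: y + z), (a *: s + t).
split; first exact: lie_gen_lin.
by rewrite rel.1 scalerDr addrACA.
Qed.

Lemma gB_h u y : gB A e f y -> gB A e f (lie_br (iota u) y).
Proof.
have [_ [_ [_ [Hhe [Hhf _]]]]] := rel.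
(* Membership is carried through the induction because the Leibniz rule for a bracket involves the
   unbracketed factors. *)
move=> hy; apply: proj2 (hy (fun y => gB A e f y /\ gB A e f (lie_br (iota u) y)) _ _ _ _).
- by rewrite lie_br0; split; exact: lie_gen0.
- move=> a x z [gx hx] [gz hz]; rewrite lie_brDr.
  by split; exact: lie_gen_lin.
- move=> x z [gx hx] [gz hz]; rewrite lie_ad -[lie_br (lie_br _ _) _]scale1r.
  by split; [|apply: lie_gen_lin]; exact: lie_gen_br.
- have gZ a x : gB A e f x -> gB A e f (a *: x).
    by move=> gx; rewrite -[_ *: _]addr0; apply: lie_gen_lin => //; exact: lie_gen0.
  move=> x hx; split; first exact: lie_gen_sub.
  have gx : gB A e f x by exact: lie_gen_sub.
  by case: hx gx => j [Ajj [->|->]] gx; rewrite ?Hhe ?Hhf; exact: gZ.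
Qed.

Lemma gBh_br u v : gBh u -> gBh v -> gBh (lie_br u v).
Proof.
have [_ [_ [Hhh _]]] := rel.
move=> [y [s [hy ->]]] [z [t [hz ->]]].
exists (lie_br y z + lie_br (iota s) z - lie_br (iota t) y), 0; split.
  rewrite addrC -scaleN1r; apply: lie_gen_lin; first exact: gB_h.
  rewrite -[lie_br y z]scale1r; apply: lie_gen_lin; last exact: gB_h.
  exact: lie_gen_br.
rewrite !lie_brDL !lie_brD Hhh addr0 -(lie_brC y).
by rewrite (iota0 rel) addr0 addrAC.
Qed.

Lemma locnil_gBh x : ad_locnil x -> gBh x.
Proof.
move=> nilx; pose J : pred 'I_l := fun i => A i i != 2.
have [u1 u1P] := choice (fun i => degree_vector (pred1 i)).
(* The sum of the grading elements of all imaginary indices measures the total imaginary degree. As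
   [x] commutes with it, only the level-zero part of [x] survives, and for this [J] that level is
   generated by the Cartan subalgebra and the real root vectors. *)
pose u0 := \sum_(i | J i) u1 i.
have u0J j : (u0 *m alpha) 0 j = (J j)%:R.
  rewrite /u0 mulmx_suml summxE (eq_bigr (fun i => (j == i)%:R)) => [|i _]; last first.
    by rewrite u1P.
  rewrite big_mkcond (bigD1 j) //= eqxx big1 => [|i /negbTE ij].
    by rewrite addr0; case: (J j).
  by rewrite eq_sym ij; case: (J i).
have dx : lie_br (iota u0) x = 0.
  apply: (big_ind (fun u => lie_br (iota u) x = 0)) => [|u v hu hv|i Ji].
  - by rewrite (iota0 rel) lie_0br.
  - by rewrite -[u]scale1r rel.1 scale1r lie_brDL hu hv addr0.
  - exact: degree_zero hg Ji nilx (u1P i).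
have [m hm] := graded_all J rel (gkm_generated hg) x.
have [g [r [hg1 hr E]]] := top_split rel u0J hm.
have r0 : r = 0.
  apply: (gen_eigen_disj (d := iota u0) (Q := fun t => t != 0) (Q' := pred1 0)) => //.
  apply: (gen_eigen_hom (z := 0)) => //; rewrite scale0r -dx E lie_brD.
  by rewrite (level0_degree rel u0J hg1) add0r.
have iota_gBh u : gBh (iota u).
  by exists 0, u; split; [exact: lie_gen0 | rewrite add0r].
rewrite E r0 addr0; apply: (hg1 gBh).
- by rewrite -(iota0 rel).
- exact: gBh_lin.
- exact: gBh_br.
- move=> y [[u ->]|[j [Jj hj]]] //.
  move: Jj; rewrite /J negbK => /eqP Ajj.
  exists y, 0; rewrite (iota0 rel) addr0; split=> //.
  by apply: lie_gen_sub; exists j.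
Qed.

End Conclusion.

End Main.

Unset Implicit Arguments.

Theorem theorem1 (l : nat) (A : 'M[RR]_l)
  (hA : BKM_matrix A) (hsym : symmetrizable A) (hind : indecomposable A)
  (hl : (2 <= l)%N)
  (alpha : 'M[CC]_(hdim A, l)) (alphav : 'M[CC]_(l, hdim A))
  (hreal : is_realization alpha alphav)
  (L : lieAlgebra CC) (iota : 'rV[CC]_(hdim A) -> L) (e f : 'I_l -> L)
  (hg : is_GKM alpha alphav iota e f) :
  (forall x : L, gB A e f x -> g_nil x) /\
  (forall x : L, g_nil x ->
     exists (y : L) (u : 'rV[CC]_(hdim A)), gB A e f y /\ x = y + iota u).
Proof.
split=> x hx.
  apply: lie_gen_mono hx => _ [i [Aii [->|->]]].
    exact: (real_locnil hA hg Aii).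
  exact: (real_locnil hA (is_GKM_opp hg) Aii).
apply: (hx (gBh iota e f)).
- by exists 0, 0; rewrite (iota0 hg.1) addr0; split=> //; exact: lie_gen0.
- exact: gBh_lin hg.
- exact: gBh_br hg.
- by move=> u; exact: (locnil_gBh hA hind hl hreal hg).
Qed.
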